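(* Let $X$ be a topological space and $X'\subset X$ an open set, with inclusion $i:X'\hookrightarrow X$, such that both $X$ and $X'$ are paracompact, and let $\mathscr{S}$ be a sheaf of abelian groups on $X$. If $0\to\mathscr{S}\to\mathscr{K}^{\bullet}$ is a soft resolution such that each $\mathscr{K}^{q}|_{X'}$ is soft, then $$M^{*}(i^{-1})\underset{\mathrm{qis}}{\simeq}\boldsymbol{R}\Gamma(X,X';\mathscr{S})\quad\text{and}\quad H^{q}(M^{*}(i^{-1}))\simeq H^{q}(X,X';\mathscr{S})\ \text{ for every } q.$$
   Context: Sheaves are sheaves of abelian groups; complexes of sheaves vanish in negative degrees. Paracompact means Hausdorff and every open covering admits a locally finite refinement. A sheaf on a paracompact space is soft if its global sections restrict surjectively onto sections over every closed subset. $\Gamma(X,X';\mathscr{S})=\mathscr{S}(X,X')$ is the group of sections of $\mathscr{S}$ over $X$ vanishing on $X'$; $\boldsymbol{R}\Gamma(X,X';\ )$ is its right derived functor, represented by $\mathscr{F}^\bullet(X,X')$ for a flabby resolution $0\to\mathscr{S}\to\mathscr{F}^\bullet$, and $H^q(X,X';\mathscr{S})$ is its $q$-th cohomology. The symbol $\underset{\mathrm{qis}}{\simeq}$ means quasi-isomorphic, i.e. isomorphic in the derived category of complexes of abelian groups bounded below. $i^{-1}:\mathscr{K}^\bullet(X)\to\mathscr{K}^\bullet(X')$ is the restriction of sections and $M^*(i^{-1})$ is its co-mapping cone: $M^*(i^{-1})^q=\mathscr{K}^q(X)\oplus\mathscr{K}^{q-1}(X')$ with differential $d(s,t)=(ds,\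 i^{-1}s-dt)$. *)

(* Defs.v *)
From HB Require Import structures.
From mathcomp Require Import all_boot all_algebra.
From mathcomp Require Import ring_quotient generic_quotient.
From mathcomp Require Import all_classical topology.

Set Implicit Arguments.
Unset Strict Implicit.
Unset Printing Implicit Defensive.

Import GRing.Theory.

Local Open Scope classical_set_scope.
Local Open Scope quotient_scope.
Local Open Scope ring_scope.

Definition zmod_iso (A B : zmodType) : Prop :=
  exists f : {additive A -> B}, bijective f.

Fact ecast_zmod0 (I : Type) (C : I -> zmodType) (p q : I) (e : p = q) :
  ecast i (C i) e 0 = 0.
Proof. by case: _ / e. Qed.

Fact ecast_zmodB (I : Type) (C : I -> zmodType) (p q : I) (e : p = q)
    (x y : C p) :
  ecast i (C i) e (x - y) = ecast i (C i) e x - ecast i (C i) e y.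
Proof. by case: _ / e. Qed.

Section Kernel.
Variables (A B : zmodType) (f : {additive A -> B}).

Definition ker_pred : {pred A} := [pred x | f x == 0].

Fact ker_pred_closed : zmod_closed ker_pred.
Proof.
split=> [|x y]; rewrite !inE ?raddf0 // => /eqP fx /eqP fy.
by rewrite raddfB fx fy subr0.
Qed.
HB.instance Definition _ := GRing.isZmodClosed.Build A ker_pred ker_pred_closed.

Record kernel := Kernel { kval : A; kvalP : kval \in ker_pred }.
HB.instance Definition _ := [isSub for kval].
HB.instance Definition _ := [Choice of kernel by <:].
HB.instance Definition _ := [SubChoice_isSubZmodule of kernel by <:].

Lemma kernelE (x : kernel) : f (val x) = 0.
Proof. by apply/eqP; case: x. Qed.

End Kernel.

Section KernelMap.
Variables (A B A' B' : zmodType).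
Variables (f : {additive A -> B}) (f' : {additive A' -> B'}).
Variables (h : {additive A -> A'}) (hP : forall x, f x = 0 -> f' (h x) = 0).

Fact kernel_map_subproof (x : kernel f) : h (val x) \in ker_pred f'.
Proof. by apply/eqP/hP/kernelE. Qed.

Definition kernel_map (x : kernel f) : kernel f' :=
  Kernel (kernel_map_subproof x).

Fact kernel_map_additive : zmod_morphism kernel_map.
Proof. by move=> x y; apply: val_inj; rewrite /= !raddfB. Qed.
HB.instance Definition _ :=
  GRing.isZmodMorphism.Build (kernel f) (kernel f') kernel_map
    kernel_map_additive.

End KernelMap.

Section QuotientMap.
Variables (A A' : zmodType) (I : zmodClosed A) (I' : zmodClosed A').
Variables (h : {additive A -> A'}).
Hypothesis hP : forall x, x \in I -> h x \in I'.

Definition quot_map (x : Quotient.quot I) : Quotient.quot I' :=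
  \pi_(Quotient.quot I') (h (repr x)).

Lemma quot_map_pi (x : A) :
  quot_map (\pi_(Quotient.quot I) x) = \pi_(Quotient.quot I') (h x).
Proof.
apply/eqP; rewrite -Quotient.idealrBE -raddfB; apply: hP.
by rewrite Quotient.idealrBE reprK.
Qed.

Fact quot_map_additive : zmod_morphism quot_map.
Proof.
move=> x y; rewrite -[x]reprK -[y]reprK -raddfB !quot_map_pi.
by rewrite !raddfB.
Qed.

End QuotientMap.

(* The differential out of degree q lands in degree [1 + q] rather than
   [q + 1] because [1 + Posz n] reduces to [Posz n.+1]. *)
Record bcomplex := BComplex {
  bobj :> int -> zmodType;
  bdiff : forall q : int, {additive bobj q -> bobj (1 + q)};
  bdiffK : forall q (x : bobj q), bdiff (1 + q) (bdiff q x) = 0;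
  bbounded : exists n : int, forall q, (q < n)%R -> forall x : bobj q, x = 0
}.

Record bhom (C D : bcomplex) := BHom {
  bfun :> forall q : int, {additive C q -> D q};
  bfunE : forall q (x : C q), bfun (1 + q) (bdiff C q x) = bdiff D q (bfun q x)
}.

Definition bid (C : bcomplex) : bhom C C :=
  @BHom C C (fun q => idfun) (fun q x => erefl).

Fact bcomp_subproof (C D E : bcomplex) (g : bhom D E) (f : bhom C D)
    (q : int) (x : C q) :
  g (1 + q) (f (1 + q) (bdiff C q x)) = bdiff E q (g q (f q x)).
Proof. by rewrite !bfunE. Qed.

Definition bcomp (C D E : bcomplex) (g : bhom D E) (f : bhom C D) : bhom C E :=
  @BHom C E (fun q => g q \o f q) (bcomp_subproof g f).

Section Cohomology.
Variables (C : bcomplex) (q : int).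

Definition cocycles : zmodType := kernel (bdiff C q).

(* Since [1 + p = q] determines p, this is the image of the differential
   coming from degree q - 1. *)
Definition is_cobound (x : C q) : Prop :=
  exists (p : int) (e : 1 + p = q) (y : C p), x = ecast i (C i) e (bdiff C p y).

Definition cobounds : {pred cocycles} := fun z => `[< is_cobound (val z) >].

Fact cobounds_closed : zmod_closed cobounds.
Proof.
split=> [|x y].
  apply/asboolP; exists (q - 1).
  have e : 1 + (q - 1) = q by rewrite addrC subrK.
  by exists e, 0; rewrite raddf0 ecast_zmod0.
move=> /asboolP[p [e [u xu]]] /asboolP[p' [e' [v yv]]]; apply/asboolP.
have pp : p' = p by apply: (@addrI _ 1); rewrite e e'.
subst p'; exists p, e, (u - v); rewrite !raddfB /= ecast_zmodB xu yv.
by rewrite (eq_irrelevance e' e).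
Qed.
HB.instance Definition _ :=
  GRing.isZmodClosed.Build cocycles cobounds cobounds_closed.

Definition cohomology : zmodType := Quotient.quot cobounds.

End Cohomology.

Section CohomologyMap.
Variables (C D : bcomplex) (f : bhom C D) (q : int).

Fact cocycles_map_subproof (x : C q) :
  bdiff C q x = 0 -> bdiff D q (f q x) = 0.
Proof. by move=> dx; rewrite -bfunE dx raddf0. Qed.

Definition cocycles_map : {additive cocycles C q -> cocycles D q} :=
  kernel_map cocycles_map_subproof.

(* f applied to a representative, independent of it by [cobounds_map]. *)
Definition cohomology_map : cohomology C q -> cohomology D q :=
  quot_map (@cobounds D q) cocycles_map.

Lemma cobounds_map (x : cocycles C q) :
  x \in @cobounds C q -> cocycles_map x \in @cobounds D q.
Proof.
move=> /asboolP[p [e [y xy]]]; apply/asboolP; exists p, e, (f p y).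
rewrite /= [kval x]xy; case: _ / (e).
by rewrite /= bfunE.
Qed.

HB.instance Definition _ :=
  GRing.isZmodMorphism.Build (cohomology C q) (cohomology D q) cohomology_map
    (quot_map_additive cobounds_map).

End CohomologyMap.

Definition quasi_iso (C D : bcomplex) (f : bhom C D) : Prop :=
  forall q : int, bijective (cohomology_map f (q := q)).

(* The derived category of bounded below complexes, as the localization of the
   category of bounded below complexes at the quasi-isomorphisms: a morphism is
   a formal composite of morphisms of complexes and of formal inverses of
   quasi-isomorphisms, modulo the congruence [deq].  Homotopic morphisms become
   equal there, so localizing the homotopy category instead gives the same
   category. *)

Inductive dpath : bcomplex -> bcomplex -> Type :=
| DId C : dpath C C
| DComp C D E : dpath D E -> dpath C D -> dpath C E
| DMor C D : bhom C D -> dpath C D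
| DInv C D (w : bhom C D) : quasi_iso w -> dpath D C.

Inductive deq : forall C D, dpath C D -> dpath C D -> Prop :=
| deq_refl C D (f : dpath C D) : deq f f
| deq_sym C D (f g : dpath C D) : deq f g -> deq g f
| deq_trans C D (f g h : dpath C D) : deq f g -> deq g h -> deq f h
| deq_congr C D E (g g' : dpath D E) (f f' : dpath C D) :
    deq g g' -> deq f f' -> deq (DComp g f) (DComp g' f')
| deq_assoc B C D E (h : dpath D E) (g : dpath C D) (f : dpath B C) :
    deq (DComp h (DComp g f)) (DComp (DComp h g) f)
| deq_idl C D (f : dpath C D) : deq (DComp (DId D) f) f
| deq_idr C D (f : dpath C D) : deq (DComp f (DId C)) f
| deq_morid C : deq (DMor (bid C)) (DId C)
| deq_morcomp C D E (g : bhom D E) (f : bhom C D) :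
    deq (DMor (bcomp g f)) (DComp (DMor g) (DMor f))
| deq_invl C D (w : bhom C D) (hw : quasi_iso w) :
    deq (DComp (DInv hw) (DMor w)) (DId C)
| deq_invr C D (w : bhom C D) (hw : quasi_iso w) :
    deq (DComp (DMor w) (DInv hw)) (DId D).

Definition derived_iso (C D : bcomplex) : Prop :=
  exists (f : dpath C D) (g : dpath D C),
    deq (DComp g f) (DId C) /\ deq (DComp f g) (DId D).

Record ncomplex := NComplex {
  nobj :> nat -> zmodType;
  ndiff : forall q : nat, {additive nobj q -> nobj q.+1};
  ndiffK : forall q (x : nobj q), ndiff q.+1 (ndiff q x) = 0
}.

Record nhom (C D : ncomplex) := NHom {
  nfun :> forall q : nat, {additive C q -> D q};
  nfunE : forall q (x : C q), nfun q.+1 (ndiff C q x) = ndiff D q (nfun q x)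
}.

Definition zmod0 : zmodType := 'rV[int]_0.

Section Extension.
Variable C : ncomplex.

Definition ext_obj (q : int) : zmodType :=
  match q with Posz n => C n | Negz _ => zmod0 end.

Definition ext_diff (q : int) : {additive ext_obj q -> ext_obj (1 + q)} :=
  match q return {additive ext_obj q -> ext_obj (1 + q)} with
  | Posz n => ndiff C n
  | Negz n => \0
  end.

Fact ext_diffK q (x : ext_obj q) : ext_diff (1 + q) (ext_diff q x) = 0.
Proof.
by case: q x => n x; [exact: ndiffK | rewrite /= raddf0].
Qed.

Fact ext_bounded :
  exists n : int, forall q, (q < n)%R -> forall x : ext_obj q, x = 0.
Proof. by exists 0 => -[n|n] //= _ x; apply/rowP; case. Qed.

Definition ext : bcomplex := BComplex ext_diffK ext_bounded.

End Extension.

Section CoCone.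
Variables (A B : ncomplex) (f : nhom A B).

(* B^(q-1), with B^(-1) = 0. *)
Definition shift_obj (q : nat) : zmodType :=
  match q with 0 => zmod0 | q'.+1 => B q' end.

Definition shift_diff (q : nat) : {additive shift_obj q -> B q} :=
  match q return {additive shift_obj q -> B q} with
  | 0 => \0
  | q'.+1 => ndiff B q'
  end.

Definition cocone_obj (q : nat) : zmodType := (A q * shift_obj q)%type.

Definition cocone_diff (q : nat) (u : cocone_obj q) : cocone_obj q.+1 :=
  (ndiff A q u.1, f q u.1 - shift_diff q u.2).

Fact cocone_diff_additive q : zmod_morphism (@cocone_diff q).
Proof.
move=> [s t] [s' t']; rewrite /cocone_diff /=; congr pair; rewrite ?raddfB //.
by rewrite /= opprB opprK addrACA [- f q s' + _]addrC.
Qed.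
HB.instance Definition _ q :=
  GRing.isZmodMorphism.Build (cocone_obj q) (cocone_obj q.+1)
    (@cocone_diff q) (@cocone_diff_additive q).

Fact cocone_diffK q (u : cocone_obj q) : cocone_diff (cocone_diff u) = 0.
Proof.
rewrite /cocone_diff /= ndiffK nfunE raddfB; congr pair.
case: q u => [|q] [s t] /=; first by rewrite raddf0 subr0 subrr.
by rewrite ndiffK subr0 subrr.
Qed.

Definition cocone : ncomplex :=
  @NComplex cocone_obj (fun q => @cocone_diff q) cocone_diffK.

End CoCone.

Definition locally_finite (T : topologicalType) (V : set (set T)) : Prop :=
  forall x : T, exists2 W, nbhs x W & finite_set [set A | V A /\ A `&` W !=set0].

Definition open_covering (T : topologicalType) (U : set (set T)) : Prop :=
  (forall A, U A -> open A) /\ \bigcup_(A in U) A = setT.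

Definition refines (T : Type) (V U : set (set T)) : Prop :=
  forall A, V A -> exists2 B, U B & A `<=` B.

Definition paracompact (T : topologicalType) : Prop :=
  hausdorff_space T /\
  forall U : set (set T), open_covering U ->
    exists V : set (set T), [/\ open_covering V, refines V U & locally_finite V].

Record opens (X : topologicalType) := Opens {
  oset :> set X;
  oopen : open oset
}.

Definition opensT (X : topologicalType) : opens X := Opens (@openT X).

Definition opensI (X : topologicalType) (U V : opens X) : opens X :=
  Opens (openI (oopen U) (oopen V)).

Lemma sub_opensT (X : topologicalType) (U : opens X) : U `<=` opensT X.
Proof. exact: subsetT. Qed.

Lemma sub_opensIl (X : topologicalType) (U V : opens X) : opensI U V `<=` U.
Proof. exact: subIsetl. Qed.

Lemma sub_opensIr (X : topologicalType) (U V : opens X) : opensI U V `<=` V.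
Proof. exact: subIsetr. Qed.

Record sheaf (X : topologicalType) := Sheaf {
  sect :> opens X -> zmodType;
  res : forall U V : opens X, V `<=` U -> {additive sect U -> sect V};
  res_id : forall (U : opens X) (h : U `<=` U) (s : sect U), res h s = s;
  res_comp : forall (U V W : opens X) (h : V `<=` U) (k : W `<=` V)
    (l : W `<=` U) (s : sect U), res k (res h s) = res l s;
  sheaf_sep : forall (I : Type) (U : I -> opens X) (V : opens X)
    (UV : forall i, U i `<=` V), V `<=` \bigcup_i U i ->
    forall s t : sect V, (forall i, res (UV i) s = res (UV i) t) -> s = t;
  sheaf_glue : forall (I : Type) (U : I -> opens X) (V : opens X)
    (UV : forall i, U i `<=` V), V `<=` \bigcup_i U i ->
    forall s : forall i, sect (U i),
      (forall i j, res (@sub_opensIl _ (U i) (U j)) (s i)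
                 = res (@sub_opensIr _ (U i) (U j)) (s j)) ->
      exists t : sect V, forall i, res (UV i) t = s i
}.

Record sheaf_hom (X : topologicalType) (F G : sheaf X) := SheafHom {
  shfun :> forall U : opens X, {additive F U -> G U};
  shfunE : forall (U V : opens X) (h : V `<=` U) (s : F U),
    shfun V (res F h s) = res G h (shfun U s)
}.

Definition flabby (X : topologicalType) (F : sheaf X) : Prop :=
  forall (U : opens X) (s : F U),
    exists t : F (opensT X), res F (@sub_opensT _ U) t = s.

Section Stalks.
Variables (X : topologicalType) (F : sheaf X).

(* sections of F defined on some open neighborhood of x *)
Record local_sect (x : X) := LocalSect {
  ls_dom : opens X;
  ls_mem : oset ls_dom x;
  ls_val : F ls_dom
}.

Definition germ_eq (x : X) (a b : local_sect x) : Prop :=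
  exists (W : opens X) (ha : W `<=` ls_dom a) (hb : W `<=` ls_dom b),
    oset W x /\ res F ha (ls_val a) = res F hb (ls_val b).

(* the stalk at x: the equivalence classes of [germ_eq] *)
Definition stalk (x : X) : Type :=
  {g : set (local_sect x) | exists a, g = [set b | germ_eq a b]}.

Definition germ (x : X) (U : opens X) (Ux : oset U x) (s : F U) : stalk x :=
  exist _ [set b | germ_eq (LocalSect Ux s) b] (ex_intro _ _ erefl).

(* Sections of F over an arbitrary subset A, i.e. continuous sections over A of
   the etale space of F: families of germs which locally on A are the germs of
   a section of F. *)
Definition is_section_over (A : set X) (s : forall x, A x -> stalk x) : Prop :=
  forall x, A x -> exists (U : opens X) (t : F U), oset U x /\
    forall y (Ay : A y) (Uy : oset U y), s y Ay = germ Uy t.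

Definition soft : Prop :=
  forall (Z : set X) (s : forall x, Z x -> stalk x),
    closed Z -> is_section_over s ->
    exists t : F (opensT X), forall x (Zx : Z x), s x Zx = @germ x (opensT X) I t.

End Stalks.

(* The restriction of F to an open X', as a sheaf on the space X': its sections
   over U, open in X', are the sections of F over U seen as an open of X. *)
Section RestrictSheaf.
Variables (X : topologicalType) (X' : opens X).

Fact open_image_set_val (U : set (set_type X')) :
  open U -> open (set_val @` U).
Proof.
case=> B oB <-.
have -> : [set set_val x | x in (set_val @^-1` B : set (set_type X'))] =
          B `&` X'.
  apply/seteqP; split=> [_ [x Bx <-]|x [Bx X'x]].
    by split=> //; exact: set_valP.
  by exists (exist _ x (mem_set X'x)).
by apply: openI => //; exact: oopen.
Qed.

Definition opens_image (U : opens (set_type X')) : opens X :=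
  Opens (open_image_set_val (oopen U)).

Variable F : sheaf X.

Let rsect (U : opens (set_type X')) : zmodType := F (opens_image U).

Let rres (U V : opens (set_type X')) (h : V `<=` U) :
    {additive rsect U -> rsect V} :=
  res F (image_subset set_val h : opens_image V `<=` opens_image U).

Fact restrict_sep (I : Type) (U : I -> opens (set_type X'))
    (V : opens (set_type X')) (UV : forall i, U i `<=` V) :
  V `<=` \bigcup_i U i ->
  forall s t : rsect V, (forall i, rres (UV i) s = rres (UV i) t) -> s = t.
Proof.
move=> cov s t st.
apply: (@sheaf_sep _ F I (fun i => opens_image (U i)) (opens_image V)
          (fun i => image_subset set_val (UV i))) => //.
by move=> _ [x /cov[i _ Ux] <-]; exists i => //; exists x.
Qed.

Fact restrict_glue (I : Type) (U : I -> opens (set_type X'))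
    (V : opens (set_type X')) (UV : forall i, U i `<=` V) :
  V `<=` \bigcup_i U i ->
  forall s : forall i, rsect (U i),
    (forall i j, rres (@sub_opensIl _ (U i) (U j)) (s i)
       = rres (@sub_opensIr _ (U i) (U j)) (s j)) ->
    exists t : rsect V, forall i, rres (UV i) t = s i.
Proof.
move=> cov s ss.
apply: (@sheaf_glue _ F I (fun i => opens_image (U i)) (opens_image V)
          (fun i => image_subset set_val (UV i))).
  by move=> _ [x /cov[i _ Ux] <-]; exists i => //; exists x.
move=> i j.
have k : opensI (opens_image (U i)) (opens_image (U j)) `<=`
         opens_image (opensI (U i) (U j)).
  move=> _ [[x Ux <-] [y Uy yx]]; exists x => //; split=> //.
  by rewrite -(val_inj yx).
have := congr1 (res F k) (ss i j).
by rewrite /rres !(res_comp _ _ (@sub_opensIl _ _ _)) !(res_comp _ _ (@sub_opensIr _ _ _)).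
Qed.

Definition sheaf_restrict : sheaf (set_type X') :=
  @Sheaf (set_type X') rsect rres
    (fun U h s => res_id _ s)
    (fun U V W h k l s => res_comp _ _ _ s)
    restrict_sep restrict_glue.

End RestrictSheaf.

Record sheaf_complex (X : topologicalType) := SheafComplex {
  scobj :> nat -> sheaf X;
  scdiff : forall q : nat, sheaf_hom (scobj q) (scobj q.+1);
  scdiffK : forall q (U : opens X) (s : scobj q U),
    scdiff q.+1 U (scdiff q U s) = 0
}.

Definition sheaf_mono (X : topologicalType) (F G : sheaf X)
    (f : sheaf_hom F G) : Prop :=
  forall U : opens X, injective (f U).

(* The image sheaf of f consists of the sections of G that are locally in the
   image of f; exactness at G says that it is the kernel of g. *)
Definition sheaf_exact (X : topologicalType) (F G H : sheaf X)
    (f : sheaf_hom F G) (g : sheaf_hom G H) : Prop :=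
  forall (U : opens X) (s : G U),
    g U s = 0 <->
    (forall x, oset U x -> exists (V : opens X) (VU : V `<=` U) (t : F V),
       oset V x /\ f V t = res G VU s).

Definition resolution (X : topologicalType) (S : sheaf X)
    (K : sheaf_complex X) (e : sheaf_hom S (K 0)) : Prop :=
  [/\ sheaf_mono e,
      sheaf_exact e (scdiff K 0)
    & forall q, sheaf_exact (scdiff K q) (scdiff K q.+1)].

Section Sections.
Variables (X : topologicalType) (K : sheaf_complex X).

Definition sections (U : opens X) : ncomplex :=
  @NComplex (fun q => K q U) (fun q => scdiff K q U)
    (fun q s => scdiffK s).

Definition sections_res (U V : opens X) (h : V `<=` U) :
    nhom (sections U) (sections V) :=
  @NHom (sections U) (sections V) (fun q => res (K q) h)
    (fun q s => esym (shfunE (scdiff K q) h s)).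

Variable X' : opens X.

(* Gamma(X, X'; F) *)
Definition rel_sect (F : sheaf X) : zmodType :=
  kernel (res F (@sub_opensT _ X')).

Fact rel_diff_subproof q (s : K q (opensT X)) :
  res (K q) (@sub_opensT _ X') s = 0 ->
  res (K q.+1) (@sub_opensT _ X')
    (scdiff K q (opensT X) s) = 0.
Proof. by move=> s0; rewrite -shfunE s0 raddf0. Qed.

Definition rel_diff q : {additive rel_sect (K q) -> rel_sect (K q.+1)} :=
  kernel_map (@rel_diff_subproof q).

Fact rel_diffK q (s : rel_sect (K q)) : rel_diff q.+1 (rel_diff q s) = 0.
Proof. by apply: val_inj; rewrite /= scdiffK. Qed.

Definition rel_sections : ncomplex :=
  @NComplex (fun q => rel_sect (K q)) rel_diff rel_diffK.

End Sections.

(* Main.v *)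
(* On a paracompact space, a bounded below exact complex of soft sheaves has
   exact global sections: its cocycles are soft by induction, since a cocycle
   has a primitive near any closed set (local primitives over a locally finite
   cover are made compatible one at a time, Zorn), and the primitive extends.

   From the complex A = K + F augmented by S -> A^0, s |-> (e s, e' s), one
   builds degree by degree a flabby complex T with a map A -> T such that
   S -> A^0 -> A^1 + T^0 -> A^2 + T^1 -> ... is exact.  Since S -> F is exact,
   so is the cone of K -> T, and likewise the cone of F -> T.  These cones are
   soft on X and on X', so K -> T and F -> T are quasi-isomorphisms on sections
   over X and over X', hence on co-mapping cones.  Finally, flabbiness of F
   makes sections over X surject onto sections over X', so that the kernel
   Gamma(X, X'; F) is quasi-isomorphic to the co-mapping cone of F. *)

Require Import Defs.
From HB Require Import structures.
From mathcomp Require Import all_boot all_algebra.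
From mathcomp Require Import ring_quotient generic_quotient finmap.
From mathcomp Require Import all_classical topology.

Set Implicit Arguments.
Unset Strict Implicit.
Unset Printing Implicit Defensive.

Import GRing.Theory.

Local Open Scope classical_set_scope.
Local Open Scope quotient_scope.
Local Open Scope ring_scope.

(** * Complexes of abelian groups *)

Lemma inj_surj_bijective (A B : Type) (f : A -> B) :
  injective f -> (forall b, exists a, f a = b) -> bijective f.
Proof.
move=> fI fS; exists (fun b => projT1 (cid (fS b))) => [a|b].
  by apply: fI; case: cid.
by case: cid.
Qed.

Lemma zmod_iso_sym (A B : zmodType) : zmod_iso A B -> zmod_iso B A.
Proof.
move=> [f [g fK gK]].
have gB : zmod_morphism g.
  by move=> x y; apply: (can_inj fK); rewrite raddfB !gK.
pose gm := GRing.isZmodMorphism.Build B A g gB.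
pose g' : {additive B -> A} := HB.pack g gm.
by exists g'; exists f.
Qed.

Lemma zmod_iso_trans (A B C : zmodType) :
  zmod_iso A B -> zmod_iso B C -> zmod_iso A C.
Proof. by move=> [f fb] [g gb]; exists (g \o f); exact: bij_comp. Qed.

Lemma derived_iso_sym (C D : bcomplex) : derived_iso C D -> derived_iso D C.
Proof. by move=> [f [g [gf fg]]]; exists g, f. Qed.

Lemma derived_iso_trans (C D E : bcomplex) :
  derived_iso C D -> derived_iso D E -> derived_iso C E.
Proof.
have cancel_mid A B M (f : dpath A B) (g : dpath B A) (f' : dpath B M)
    (g' : dpath M B) : deq (DComp g f) (DId A) -> deq (DComp g' f') (DId B) ->
    deq (DComp (DComp g g') (DComp f' f)) (DId A).
  move=> gf gf'; apply: deq_trans gf.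
  apply: deq_trans (deq_sym (deq_assoc _ _ _)) _.
  apply: deq_congr; first exact: deq_refl.
  apply: deq_trans (deq_assoc _ _ _) _.
  apply: deq_trans (deq_congr gf' (deq_refl _)) _.
  exact: deq_idl.
move=> [f [g [gf fg]]] [f' [g' [gf' fg']]].
by exists (DComp f' f), (DComp g g'); split; exact: cancel_mid.
Qed.

Lemma quasi_iso_derived (C D : bcomplex) (w : bhom C D) :
  quasi_iso w -> derived_iso C D.
Proof.
move=> hw; exists (DMor w), (DInv hw).
by split; [exact: deq_invl | exact: deq_invr].
Qed.

Lemma quasi_iso_cohomology (C D : bcomplex) (w : bhom C D) :
  quasi_iso w -> forall q, zmod_iso (cohomology C q) (cohomology D q).
Proof. by move=> hw q; exists (@cohomology_map C D w q); exact: hw. Qed.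

(** Trades the integer [p] with [1 + p = q] for [shift_obj]. In degree 0 the incoming differential
    starts in degree -1, where [ext A] is zero, and [shift_diff] is zero there too. *)
Lemma is_cobound_ext (A : ncomplex) (q : nat) (x : A q) :
  is_cobound (C := ext A) (q := Posz q) x <->
  exists v : shift_obj A q, x = shift_diff A q v.
Proof.
case: q x => [|q] x; split.
- move=> [p [e [y xy]]]; exists 0; rewrite /= xy.
  case: p e y {xy} => [p|[|p]] e y //=.
  by rewrite /= ecast_zmod0.
- move=> [v ->] /=; exists (Negz 0), erefl, 0.
  by rewrite /=.
- move=> [p [e [y xy]]].
  have pq : p = Posz q by apply: (@addrI _ 1); rewrite e.
  subst p; exists y; rewrite xy; by rewrite (eq_irrelevance e erefl).
- by move=> [v ->]; exists (Posz q), erefl, v.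
Qed.

Lemma pi_cohomology_eq0 (C : bcomplex) (q : int) (x : cocycles C q) :
  \pi_(cohomology C q) x = 0 <-> is_cobound (val x).
Proof.
have <- : \pi_(cohomology C q) 0 = 0 by exact: raddf0.
split=> [/eqP|xb]; last apply/eqP; rewrite -Quotient.idealrBE subr0.
  by move/asboolP.
exact/asboolP.
Qed.

Lemma pi_cohomology_surj (C : bcomplex) (q : int) (z : cohomology C q) :
  exists x, z = \pi_(cohomology C q) x.
Proof. by exists (repr z); rewrite reprK. Qed.

Lemma cohomology_map_pi (C D : bcomplex) (f : bhom C D) (q : int)
    (x : cocycles C q) :
  cohomology_map f (\pi_(cohomology C q) x) =
  \pi_(cohomology D q) (cocycles_map f q x).
Proof. exact: (quot_map_pi (@cobounds_map _ _ f q)). Qed.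

Lemma zmod0_eq (x y : zmod0) : x = y.
Proof. by apply/rowP; case. Qed.

(** Through [shift_obj], exactness in degree 0 amounts to injectivity of the first differential. *)
Definition acyclic (C : ncomplex) : Prop :=
  forall q (u : C q), ndiff C q u = 0 ->
    exists v : shift_obj C q, u = shift_diff C q v.

Section ExtHom.
Variables (A B : ncomplex) (f : nhom A B).

Definition ext_hom_fun (q : int) : {additive ext A q -> ext B q} :=
  match q return {additive ext A q -> ext B q} with
  | Posz n => f n
  | Negz _ => idfun
  end.

Fact ext_homE q (x : ext A q) :
  ext_hom_fun (1 + q) (bdiff (ext A) q x) = bdiff (ext B) q (ext_hom_fun q x).
Proof. by case: q x => n x; [exact: nfunE | rewrite /= raddf0]. Qed.

Definition ext_hom : bhom (ext A) (ext B) := BHom ext_homE.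

(** If [x] is a cocycle of [A] and [f x = d v], then [(x, v)] is a cocycle of the cocone, and a
    primitive of it makes [x] a coboundary. If [y] is a cocycle of [B], then [(0, y)] is one in the
    next degree, and a primitive [w] satisfies [d w.1 = 0] and [f w.1 - y = d w.2]. *)
Lemma acyclic_quasi_iso : acyclic (cocone f) -> quasi_iso ext_hom.
Proof.
move=> ac q; apply: inj_surj_bijective.
  apply: raddf_inj => z; have [x ->] := pi_cohomology_surj z.
  move=> /(etrans (esym (cohomology_map_pi ext_hom x)))/pi_cohomology_eq0 xb.
  apply/pi_cohomology_eq0.
  have := kernelE x; move: xb; rewrite /=.
  case: q {ac z} x (ac) => q x ac; last first.
    move=> _ _; have -> : val x = 0 by apply/rowP; case.
    exists (Negz q - 1).
    have e : 1 + (Negz q - 1) = Negz q by rewrite addrC subrK.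
    by exists e, 0; rewrite raddf0 ecast_zmod0.
  move=> /is_cobound_ext[v xv] dx; apply/is_cobound_ext.
  have [|w xw] := ac q (val x, v).
    by rewrite /= /cocone_diff /= [ndiff _ _ _]dx [f _ _]xv subrr.
  case: q x v xv dx w xw => [|q] x v xv dx w xw.
    by exists 0; move: xw => /= [-> _].
  by exists w.1; move: xw => /= [-> _].
move=> z; have [y ->] := pi_cohomology_surj z; move: y {z} => y.
have := kernelE y; case: q y => q y /= dy; last first.
  have -> : y = 0 by apply: val_inj; apply/rowP; case.
  by exists 0; rewrite !raddf0.
have [|w yw] := ac q.+1 (0, val y).
  by rewrite /= /cocone_diff /= raddf0 [ndiff B _ _]dy raddf0 subrr.
have /= [w1 w2] := yw.
have xP : w.1 \in ker_pred (bdiff (ext A) q) by rewrite inE -w1.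
exists (\pi_(cohomology (ext A) q) (Kernel xP)).
rewrite cohomology_map_pi; apply/eqP.
rewrite -Quotient.idealrBE; apply/asboolP/is_cobound_ext => /=.
by exists w.2; transitivity (f q w.1 - kval y); rewrite // w2 subKr.
Qed.

End ExtHom.

Section ShiftHom.
Variables (A B : ncomplex) (f : nhom A B).

Definition shift_hom (q : nat) : {additive shift_obj A q -> shift_obj B q} :=
  match q return {additive shift_obj A q -> shift_obj B q} with
  | 0 => idfun
  | q'.+1 => f q'
  end.

Lemma shift_homE q (x : shift_obj A q) :
  f q (shift_diff A q x) = shift_diff B q (shift_hom q x).
Proof. by case: q x => [|q] x /=; rewrite ?raddf0 ?nfunE. Qed.

End ShiftHom.

Section Square.
Variables (A B A' B' : ncomplex) (f : nhom A B) (f' : nhom A' B').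
Variables (a : nhom A A') (b : nhom B B').
Hypothesis comm : forall q (x : A q), b q (f q x) = f' q (a q x).

Definition cocone_map_fun q (u : cocone f q) : cocone f' q :=
  (a q u.1, shift_hom b q u.2).

Fact cocone_map_additive q : zmod_morphism (@cocone_map_fun q).
Proof. by move=> x y; rewrite /cocone_map_fun !raddfB. Qed.
HB.instance Definition _ q :=
  GRing.isZmodMorphism.Build (cocone f q) (cocone f' q) (@cocone_map_fun q)
    (@cocone_map_additive q).

Fact cocone_mapE q (u : cocone f q) :
  cocone_map_fun (ndiff (cocone f) q u) =
  ndiff (cocone f') q (cocone_map_fun u).
Proof.
rewrite /cocone_map_fun /= /cocone_diff /= nfunE; congr pair.
by rewrite raddfB comm shift_homE.
Qed.

Definition cocone_map : nhom (cocone f) (cocone f') :=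
  @NHom (cocone f) (cocone f') (fun q => @cocone_map_fun q) cocone_mapE.

(** Up to signs and order of summands, the iterated cocone is that of the map [cocone a -> cocone b]
    induced by [f] and [f']. A primitive of the [A] and [A'] components is therefore chosen first,
    and then one of what remains in [cocone b]. *)
Lemma acyclic_cocone_map :
  acyclic (cocone a) -> acyclic (cocone b) -> acyclic (cocone cocone_map).
Proof.
move=> aca acb q; case: q => [|p] [[x y] w] /= H.
  move: (H) => /= [dx fx ax bx].
  have [|v /(congr1 fst) /= ->] := aca 0%N (x, 0).
    by rewrite /= /cocone_diff /= dx subr0; move: ax; rewrite subr0 => ->.
  by exists 0; congr ((_, _), _); exact: zmod0_eq.
have /= [dx /eqP] := congr1 fst H; rewrite subr_eq0 => /eqP fx.
have /= [/eqP] := congr1 snd H; rewrite subr_eq0 => /eqP ax /eqP.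
rewrite subr_eq0 => /eqP bx.
case: w ax bx {H} => x' y' /= ax bx.
have [|[u u'] /= [xu x'u]] := aca p.+1 (x, x').
  by rewrite /= /cocone_diff /= dx ax subrr.
(* What is left after subtracting the differential of [(u, u')]. Exchanging the two cocone
   directions costs the sign of the second entry here, and that of [v.1] in the final primitive. *)
have [|v ev] := acb p (y - f p u, - (shift_hom f' p u' + y')).
  rewrite /= /cocone_diff /= !raddfB /= -nfunE -xu fx subrr; congr pair.
  rewrite bx comm x'u raddfN opprK raddfB raddfD shift_homE /=.
  by apply/eqP; rewrite addr_eq0 addrC !addrA addNr add0r opprD.
have /= /eqP := congr1 fst ev; rewrite subr_eq => /eqP ye.
have /= /eqP := congr1 snd ev; rewrite eqr_oppLR => /eqP ze.
clear aca acb ev fx ax bx dx; subst x x'.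
case: p u u' y y' v ye ze => [|r] u u' y y' v ye ze /=.
  exists ((u, 0), 0); rewrite /cocone_diff /cocone_map_fun.
  congr ((_, _), (_, _)); last exact: zmod0_eq.
  by rewrite ye /= add0r subr0.
exists ((u, - v.1), (u', v.2)); congr ((_, _), (_, _)).
  by rewrite ye /= raddfN opprK addrC.
transitivity (b r (- v.1) - (f' r u' - shift_diff B' r v.2)) => //.
apply: (addrI (f' r u')); rewrite ze /= raddfN !opprB.
by rewrite [RHS]addrCA [f' r u' + _]addrC subrK addrC.
Qed.

End Square.

(** * Paracompact spaces *)

Section LocallyFinite.
Variables (X : topologicalType) (I : Type).

(** Indexed, unlike [locally_finite], so that members can be replaced by their closures or carry
    sections even when they coincide as sets. *)
Definition locally_finite_family (D : I -> set X) : Prop :=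
  forall x : X, exists2 W, nbhs x W & finite_set [set i | D i `&` W !=set0].

(** Only finitely many [D i] meet a suitable neighborhood of [x]; for the other indices the
    implication is vacuous there. *)
Lemma near_locally_finite (D : I -> set X) (P : I -> X -> Prop) (x : X) :
  locally_finite_family D -> (forall i, \forall y \near x, D i y -> P i y) ->
  \forall y \near x, forall i, D i y -> P i y.
Proof.
move=> /(_ x)[W xW finW] nP.
(* [{classic I}] supplies the choice structure on indices that [fset_set] asks for. *)
pose J : set {classic I} := [set i | D i `&` W !=set0].
have nJ : nbhs x (\bigcap_(i in [set` fset_set J]) [set y | D i y -> P i y]).
  by apply: filter_bigI => i _; exact: nP.
near=> y => i Dy.
have Wy : W y by near: y.
have H : (\bigcap_(i in [set` fset_set J]) [set y | D i y -> P i y]) y.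
  by near: y.
apply: (H i) => //=.
by rewrite in_fset_set// inE; exists y.
Unshelve. all: by end_near.
Qed.

(** An open set that meets the closure of [D i] meets [D i]. *)
Lemma locally_finite_closure (D : I -> set X) :
  locally_finite_family D -> locally_finite_family (closure \o D).
Proof.
move=> lfD x; have [W xW finW] := lfD x.
exists (interior W); first exact: nbhs_interior.
apply: sub_finite_set finW => i [y [Dy Wy]].
exact: Dy.
Qed.

Lemma closed_bigcup_locally_finite (D : I -> set X) :
  locally_finite_family D -> (forall i, closed (D i)) ->
  closed (\bigcup_i D i).
Proof.
move=> lfD cD x xD; apply: contrapT => nDx.
have /xD[y [[i _ Diy]]] : \forall y \near x, forall i, D i y -> False.
  apply: near_locally_finite => // i.
  apply: (open_nbhs_nbhs (A := ~` D i)); split.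
    by rewrite openC.
  by move=> Dx; apply: nDx; exists i.
by move=> /(_ i Diy).
Qed.

End LocallyFinite.

Lemma not_closure (X : topologicalType) (A : set X) (x : X) :
  ~ closure A x -> exists2 B, open_nbhs x B & A `&` B = set0.
Proof.
move=> /existsNP[B] /not_implyP[xB AB0].
move: xB; rewrite nbhsE => -[C xC CB]; exists C => //.
apply: contrapT => /eqP/set0P[y [Ay Cy]]; apply: AB0.
by exists y; split => //; exact: CB.
Qed.

Section Paracompact.
Variable X : topologicalType.
Hypothesis pX : paracompact X.

Lemma locally_finite_sub (V P : set (set X)) : locally_finite V -> P `<=` V ->
  locally_finite_family (fun A : {A | P A} => sval A).
Proof.
move=> lfV PV x; have [W xW finW] := lfV x; exists W => //.
rewrite (_ : [set i : {A | P A} | sval i `&` W !=set0] =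
  sval @^-1` [set A | V A /\ A `&` W !=set0]).
  apply: finite_preimage finW => -[A PA] [B PB] _ _ /= AB.
  by subst B; congr exist; exact: Prop_irrelevance.
by apply/seteqP; split=> [[A PA] /= AW|[A PA] /= []//]; split=> //; exact: PV.
Qed.

(** Refine the cover by the open sets that lie in [V] or whose closure misses [x]. By local
    finiteness, [x] is not in the closure of the union [U] of the members not contained in [V]. The
    complement of that closure is the desired neighborhood: its closure misses the open set [U], so
    it lies in [V]. *)
Lemma paracompact_regular (x : X) (V : set X) : open V -> V x ->
  exists O : set X, [/\ open O, O x & closure O `<=` V].
Proof.
move=> oV Vx.
have [T2 /(_ [set A | open A /\ (~ closure A x \/ A `<=` V)])] := pX.
case=> [|W [[oW covW] Wref lfW]].
  split=> [A []//|]; apply/seteqP; split => // y _.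
  have [Vy|nVy] := pselect (V y); first by exists V => //; split => //; right.
  have : x != y by apply/eqP => xy; apply: nVy; rewrite -xy.
  move: T2; rewrite open_hausdorff => /[apply].
  move=> -[[A B] /= [xA yB] [oA oB /eqP AB0]].
  exists B; last exact: set_mem.
  split => //; left => /(_ A (open_nbhs_nbhs (conj oA (set_mem xA)))).
  by rewrite setIC AB0 => -[].
pose P := [set A | W A /\ ~ A `<=` V].
have lfP : locally_finite_family (fun A : {A | P A} => sval A).
  by apply: (locally_finite_sub lfW) => A [].
pose U := \bigcup_(A in P) A.
have nU : ~ closure U x.
  have nx : \forall y \near x, forall A : {A | P A}, sval A y -> False.
    apply: near_locally_finite => // -[A [WA AV]] /=.
    have [B [oB [nBx|BV]] AB] := Wref A WA; last first.
      by case: AV; exact: subset_trans BV.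
    have [C xC BC0] := not_closure nBx.
    near=> y => Ay; have : (B `&` C) y.
      split; first exact: AB.
      by near: y; exact: open_nbhs_nbhs.
    by rewrite BC0.
  by move=> /(_ _ nx)[y [[A PA Ay] /(_ (exist _ A PA) Ay)]].
exists (~` closure U); split=> //.
  by rewrite openC; exact: closed_closure.
have : closed (~` U).
  by rewrite -openC setCK; apply: bigcup_open => A [WA _]; exact: oW.
move=> /closure_id UC; apply: (@subset_trans _ (~` U)).
  rewrite UC; apply: closureS; apply: subsetC; exact: subset_closure.
move=> y nUy; apply: contrapT => nVy; apply: nUy.
have [A WA Ay] : (\bigcup_(A in W) A) y by rewrite covW.
by exists A => //; split => // AV; apply: nVy; exact: AV.
Unshelve. all: by end_near.
Qed.

(** By regularity, the open sets with closure in some [O k], together with those missing [Z], cover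
    the space. In a locally finite refinement, the members that meet [Z] are kept. *)
Lemma paracompact_refine (K : Type) (Z : set X) (O : K -> set X) :
  closed Z -> (forall k, open (O k)) -> Z `<=` \bigcup_k O k ->
  exists (I : Type) (D : I -> set X) (r : I -> K),
    [/\ forall i, open (D i), locally_finite_family D,
        forall i, closure (D i) `<=` O (r i) & Z `<=` \bigcup_i D i].
Proof.
move=> cZ oO ZO.
pose U := [set A | open A /\
  ((exists k, closure A `<=` O k) \/ A `&` Z = set0)].
have [_ /(_ U)] := pX; case=> [|W [[oW covW] Wref lfW]].
  split=> [A []//|]; apply/seteqP; split => // y _.
  have [Zy|nZy] := pselect (Z y).
    have [k _ Oky] := ZO y Zy.
    have [A [oA Ay AO]] := paracompact_regular (oO k) Oky.
    by exists A => //; split => //; left; exists k.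
  exists (~` Z) => //; split; first by rewrite openC.
  by right; exact: setICl.
pose P := [set A | W A /\ A `&` Z !=set0].
have Pk (A : {A | P A}) : exists k, closure (sval A) `<=` O k.
  case: A => A [WA [z [Az Zz]]] /=.
  have [B [oB [[k BO]|BZ]] AB] := Wref A WA.
    by exists k; apply: subset_trans BO; exact: closureS.
  have : (B `&` Z) z by split=> //; exact: AB.
  by rewrite BZ.
exists {A | P A}, sval, (fun A => sval (cid (Pk A))); split.
- by move=> [A [WA ?]]; exact: oW.
- by apply: (locally_finite_sub lfW) => A [].
- by move=> A; exact: svalP (cid (Pk A)).
- move=> z Zz; have [A WA Az] : (\bigcup_(A in W) A) z by rewrite covW.
  have PA : P A by split => //; exists z.
  by exists (exist _ A PA).
Qed.

End Paracompact.

(** * Extending and lifting sections near a closed set *)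

Section Agree.
Variables (X : topologicalType) (F : sheaf X).

(** Equality of germs at [x], stated without stalks so that sections with different domains compare
    directly. *)
Definition agree (x : X) (U V : opens X) (s : F U) (t : F V) : Prop :=
  exists (W : opens X) (hU : W `<=` U) (hV : W `<=` V),
    oset W x /\ res F hU s = res F hV t.

Lemma res_eq_sub (U V W W' : opens X) (hU : W `<=` U) (hV : W `<=` V)
    (h : W' `<=` W) (hU' : W' `<=` U) (hV' : W' `<=` V) (s : F U) (t : F V) :
  res F hU s = res F hV t -> res F hU' s = res F hV' t.
Proof. by move=> st; rewrite -(res_comp hU h) st res_comp. Qed.

Lemma agree_refl x (U : opens X) (s : F U) : oset U x -> agree x s s.
Proof. by move=> Ux; exists U, (@subset_refl _ U), (@subset_refl _ U). Qed.

Lemma agree_sym x (U V : opens X) (s : F U) (t : F V) :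
  agree x s t -> agree x t s.
Proof. by move=> [W [hU [hV [Wx st]]]]; exists W, hV, hU. Qed.

Lemma agree_trans x (U V W : opens X) (s : F U) (t : F V) (r : F W) :
  agree x s t -> agree x t r -> agree x s r.
Proof.
move=> [A [h1 [h2 [Ax st]]]] [B [k1 [k2 [Bx tr]]]].
have hA := @sub_opensIl _ A B; have hB := @sub_opensIr _ A B.
exists (opensI A B), (subset_trans hA h1), (subset_trans hB k2).
split=> //; transitivity (res F (subset_trans hA h2) t).
  exact: res_eq_sub st.
exact: res_eq_sub tr.
Qed.

Lemma agree_res x (U V : opens X) (h : V `<=` U) (s : F U) :
  oset V x -> agree x (res F h s) s.
Proof.
by move=> Vx; exists V, (@subset_refl _ V), h; split=> //; rewrite res_id.
Qed.

Lemma agree_near x (U V : opens X) (s : F U) (t : F V) :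
  agree x s t -> \forall y \near x, agree y s t.
Proof.
move=> [W [hU [hV [Wx st]]]]; have xW : nbhs x W.
  by apply: open_nbhs_nbhs; split => //; exact: oopen.
by apply: filterS xW => y Wy; exists W, hU, hV.
Qed.

Lemma open_agree (U V : opens X) (s : F U) (t : F V) :
  open [set x | agree x s t].
Proof. by rewrite openE => x; exact: agree_near. Qed.

Lemma agreeD x (U V : opens X) (s s' : F U) (t t' : F V) :
  agree x s t -> agree x s' t' -> agree x (s + s') (t + t').
Proof.
move=> [A [h1 [h2 [Ax st]]]] [B [k1 [k2 [Bx tr]]]].
have hA := @sub_opensIl _ A B; have hB := @sub_opensIr _ A B.
exists (opensI A B), (subset_trans hA h1), (subset_trans hA h2).
split=> //; rewrite !raddfD; congr (_ + _); first exact: res_eq_sub st.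
exact: res_eq_sub tr.
Qed.

Lemma agree_eq (U : opens X) (s t : F U) :
  (forall x, oset U x -> agree x s t) -> s = t.
Proof.
move=> st; pose W (x : {x | oset U x}) := projT1 (cid (st _ (svalP x))).
have WU x : W x `<=` U by rewrite /W; case: cid => ? [].
apply: (@sheaf_sep _ F _ W U WU) => [x Ux|x].
  by exists (exist _ x Ux) => //; rewrite /W; case: cid => ? [? [? []]].
move: (WU x); rewrite /W; case: cid => V [hU [hV [_ e]]] /= h.
exact: res_eq_sub e.
Qed.

Lemma agree_glue (I : Type) (U : I -> opens X) (s : forall i, F (U i)) :
  (forall i j x, oset (U i) x -> oset (U j) x -> agree x (s i) (s j)) ->
  exists (W : opens X) (t : F W),
    (forall i, U i `<=` W) /\ forall i x, oset (U i) x -> agree x t (s i).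
Proof.
move=> ss; have oW : open (\bigcup_i (U i : set X)).
  by apply: bigcup_open => i _; exact: oopen.
have UW i : U i `<=` Opens oW by move=> x Ux; exists i.
have [i j|t ts] := @sheaf_glue _ F I U (Opens oW) UW (@subset_refl _ _) s.
  apply: agree_eq => x [Ux Ux'].
  apply: agree_trans (agree_res _ _ _) _ => //.
  apply: agree_trans (agree_sym (agree_res _ _ _)) => //.
  exact: ss.
exists (Opens oW), t; split=> // i x Ux; rewrite -(ts i).
exact/agree_sym/agree_res.
Qed.

End Agree.

Lemma agree_hom (X : topologicalType) (F G : sheaf X) (f : sheaf_hom F G)
    (x : X) (U V : opens X) (s : F U) (t : F V) :
  agree x s t -> agree x (f U s) (f V t).
Proof.
move=> [W [hU [hV [Wx st]]]]; exists W, hU, hV; split=> //.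
by rewrite -!shfunE st.
Qed.

Section Extend.
Variables (X : topologicalType) (F : sheaf X).
Hypothesis pX : paracompact X.

(** The sections agree only at points of [Z]. After a locally finite refinement, the points where
    all relevant sections agree form an open set containing [Z], and the sections glue there. *)
Lemma extend_near (K : Type) (Z : set X) (O : K -> opens X)
    (t : forall k, F (O k)) :
  closed Z -> Z `<=` \bigcup_k O k ->
  (forall k l x, Z x -> oset (O k) x -> oset (O l) x -> agree x (t k) (t l)) ->
  exists (W : opens X) (s : F W),
    Z `<=` W /\ forall k x, Z x -> oset (O k) x -> agree x s (t k).
Proof.
move=> cZ ZO tt.
have [I [D [r [oD lfD DO ZD]]]] :=
  paracompact_refine pX cZ (fun k => oopen (O k)) ZO.
(* Closures make [A] open: a point outside [closure (D i)] has a neighborhood missing it, so no new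
   condition appears nearby. *)
pose A := [set x | forall i j, closure (D i) x -> closure (D j) x ->
                     agree x (t (r i)) (t (r j))].
have lfC := locally_finite_closure lfD.
have near_closure i x (P : X -> Prop) :
    (closure (D i) x -> \forall y \near x, P y) ->
    \forall y \near x, closure (D i) y -> P y.
  have [Cx /(_ Cx)|nCx _] := pselect (closure (D i) x).
    by apply: filterS => y.
  have : nbhs x (~` closure (D i)).
    apply: open_nbhs_nbhs; split => //.
    by rewrite openC; exact: closed_closure.
  by apply: filterS => y ny /ny.
have oA : open A.
  rewrite openE => x Ax.
  suff : \forall y \near x, forall i, closure (D i) y ->
      forall j, closure (D j) y -> agree y (t (r i)) (t (r j)).
    by apply: filterS => y H i j Di; exact: H.
  apply: near_locally_finite => // i; apply: (near_closure) => Ci.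
  apply: near_locally_finite => // j; apply: (near_closure) => Cj.
  by apply: agree_near; exact: Ax.
pose U i := opensI (Opens (oD i)) (Opens oA).
have UO i : U i `<=` O (r i).
  by move=> x [Dx _]; apply: DO; exact: subset_closure.
have [i j x [Dx Ax] [Dx' _]|W [s [UW st]]] :=
  @agree_glue _ F I U (fun i => res F (UO i) (t (r i))).
  apply: agree_trans (agree_res _ _ _) _; first by split.
  apply: agree_trans (agree_sym (agree_res _ _ _)); last by split.
  by apply: Ax; exact: subset_closure.
have ZU z : Z z -> exists2 i, D i z & oset (U i) z.
  move=> Zz; have [i _ Di] := ZD z Zz; exists i => //; split => // j k Cj Ck.
  by apply: tt => //; exact: DO.
exists W, s; split => [z /ZU[i _ /UW]//|k z Zz Oz].
have [i Di Ui] := ZU z Zz.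
apply: agree_trans (st i z Ui) _; apply: agree_trans (agree_res _ _ Ui) _.
by apply: tt => //; apply: DO; exact: subset_closure.
Qed.

(** Reduces to [extend_near] by replacing the closed sets [C p] with small open sets on which [t p]
    already agrees with every [t q] along [C q]. Local finiteness provides such a set around each
    point of [Z] in [C p]. *)
Lemma extend_closed_family (P : Type) (C : P -> set X) (V : P -> opens X)
    (t : forall p, F (V p)) (Z : set X) :
  locally_finite_family C -> (forall p, closed (C p)) ->
  (forall p, C p `<=` V p) -> closed Z -> Z `<=` \bigcup_p C p ->
  (forall p q x, Z x -> C p x -> C q x -> agree x (t p) (t q)) ->
  exists (W : opens X) (s : F W),
    Z `<=` W /\ forall p x, Z x -> C p x -> agree x s (t p).
Proof.
move=> lfC cC CV cZ ZC tt.
pose good (k : P * opens X) := k.2 `<=` V k.1 /\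
  forall y, oset k.2 y -> forall q, C q y -> agree y (t k.1) (t q).
pose K := {k | good k}.
have KV (k : K) : (sval k).2 `<=` V (sval k).1 by case: k => k [].
have cov z : Z z -> exists k : K, oset (sval k).2 z.
  move=> Zz; have [p _ Cz] := ZC z Zz.
  have : nbhs z [set y | forall q, C q y -> agree y (t p) (t q)].
    apply: near_locally_finite => // q.
    have [Cqz|nCqz] := pselect (C q z).
      by apply: filterS (agree_near (tt p q z Zz Cz Cqz)) => y.
    have : nbhs z (~` C q) by apply: open_nbhs_nbhs; split => //; rewrite openC.
    by apply: filterS => y ny /ny.
  rewrite nbhsE => -[B [oB Bz] BP].
  have gk : good (p, opensI (V p) (Opens oB)).
    by split=> [y []//|y [_ By]]; exact: BP.
  by exists (exist _ _ gk) => //; split => //; exact: CV.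
have kt (k : K) x p : oset (sval k).2 x -> C p x ->
    agree x (t (sval k).1) (t p).
  by case: k => k [kV kP] /= Ox; exact: kP.
have [z Zz|k l x Zx Ox Ox'|W [s [ZW st]]] := @extend_near K Z
    (fun k => (sval k).2) (fun k => res F (KV k) (t (sval k).1)) cZ.
- by have [k kz] := cov z Zz; exists k.
(* Two of these sections are compared at [x] through a third one, [t q] with [x] in [C q]. *)
- have [q _ Cq] := ZC x Zx.
  apply: agree_trans (agree_res _ _ Ox) _.
  apply: agree_trans (agree_sym (agree_res _ _ Ox')).
  apply: agree_trans (kt k x q Ox Cq) _.
  exact/agree_sym/kt.
- exists W, s; split=> // p z Zz Cz; have [k kz] := cov z Zz.
  apply: agree_trans (st k z Zz kz) _.
  by apply: agree_trans (agree_res _ _ kz) _; exact: kt.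
Qed.

End Extend.

(* Softness with sections over closed sets replaced by sections over their
   neighborhoods, so that it makes sense for a subsheaf given by a predicate:
   for P := (g = 0) it is the softness of the kernel of g. *)
Definition nbhd_soft (X : topologicalType) (F : sheaf X)
    (P : forall U, F U -> Prop) : Prop :=
  forall (Z : set X) (U : opens X) (s : F U), closed Z -> Z `<=` U -> P U s ->
    exists2 t : F (opensT X), P (opensT X) t & forall x, Z x -> agree x t s.

Section Lift.
Variables (X : topologicalType) (B C : sheaf X) (g : sheaf_hom B C).
Hypothesis pX : paracompact X.
Hypothesis softg : nbhd_soft (fun U (s : B U) => g U s = 0).

(** In a maximal compatible family of local lifts, no index is missing: two lifts of [c] differ by a
    section of the kernel of [g], and softness of that kernel lets a new lift be corrected to match
    those already chosen. The full family then extends to a neighborhood of [Z]. *)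
Lemma lift_near (Z : set X) (U : opens X) (c : C U) :
  closed Z -> Z `<=` U ->
  (forall x, Z x -> exists (V : opens X) (VU : V `<=` U) (b : B V),
     oset V x /\ g V b = res C VU c) ->
  exists (W : opens X) (b : B W),
    Z `<=` W /\ forall x, Z x -> agree x (g W b) c.
Proof.
move=> cZ ZU locl.
pose K := {V : opens X & {b : B V | exists VU : V `<=` U, g V b = res C VU c}}.
have ZK : Z `<=` \bigcup_(k : K) tag k.
  move=> z /locl[V [VU [b [Vz bc]]]].
  by exists (existT _ V (exist _ b (ex_intro _ VU bc))).
have [I [D [r [oD lfD Dr ZD]]]] :=
  paracompact_refine pX cZ (fun k : K => oopen (tag k)) ZK.
pose V i := tag (r i).
pose T := {i : I & B (V i)}.
pose compat (p q : T) := forall x, Z x -> closure (D (tag p)) x ->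
  closure (D (tag q)) x -> agree x (tagged p) (tagged q).
(* Zorn applies to families of lifts on the V i rather than to lifts near a
   union of the closure (D i): along a chain, the neighborhoods carrying the
   latter shrink, and their intersection need not be a neighborhood. *)
pose clique (G : set T) :=
  [/\ forall p, G p -> exists VU : V (tag p) `<=` U,
        g _ (tagged p) = res C VU c,
      forall p q, G p -> G q -> tag p = tag q -> p = q &
      forall p q, G p -> G q -> compat p q].
(* Each clique condition involves at most two members, and two members of the union of a chain lie
   in a common clique. *)
have [G [[Gc Ginj Gcompat] Gmax]] :
    exists A, clique A /\ forall B, A `<` B -> ~ clique B.
  apply: Zorn_bigcup => F Fc Ftot; split.
  - by move=> p [A FA Ap]; have [+ _ _] := Fc A FA; exact.
  - move=> p q [A FA Ap] [A' FA' Aq].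
    have [AA'|AA'] := Ftot A A' FA FA'.
      by have [_ + _] := Fc A' FA'; apply => //; exact: AA'.
    by have [_ + _] := Fc A FA; apply => //; exact: AA'.
  - move=> p q [A FA Ap] [A' FA' Aq].
    have [AA'|AA'] := Ftot A A' FA FA'.
      by have [_ _] := Fc A' FA'; apply => //; exact: AA'.
    by have [_ _] := Fc A FA; apply => //; exact: AA'.
have lfG : locally_finite_family
    (fun p : {p | G p} => closure (D (tag (sval p)))).
  move=> x; have [W xW finW] := locally_finite_closure lfD x; exists W => //.
  apply: (@finite_preimage _ _ _ (fun p : {p | G p} => tag (sval p))) finW.
  move=> [p Gp] [q Gq] _ _ /= /(Ginj p q Gp Gq) pq.
  by subst q; congr exist; exact: Prop_irrelevance.
have ext (Z' : set X) : closed Z' -> Z' `<=` Z ->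
    Z' `<=` \bigcup_(p : {p | G p}) closure (D (tag (sval p))) ->
    exists (W : opens X) (s : B W), Z' `<=` W /\
      forall p x, Z' x -> G p -> closure (D (tag p)) x -> agree x s (tagged p).
  move=> cZ' Z'Z Z'G.
  have [||p q x Zx Cp Cq|W [s [ZW st]]] :=
    @extend_closed_family _ B pX {p | G p}
      (fun p => closure (D (tag (sval p)))) (fun p => V (tag (sval p)))
      (fun p => tagged (sval p)) Z' lfG _ _ cZ' Z'G.
  - by move=> p; exact: closed_closure.
  - by move=> p; exact: Dr.
  - by apply: Gcompat => //; [exact: svalP | exact: svalP | exact: Z'Z].
  - by exists W, s; split=> // p x Zx Gp; exact: (st (exist _ p Gp)).
have agree_c p x : G p -> oset (V (tag p)) x -> agree x (g _ (tagged p)) c.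
  by move=> /Gc[VU ->] Vx; exact: agree_res.
(* If [i] were missing, the members of [G] would give one lift [s] near [Z'], the part of [Z] in
   [closure (D i)] where a new lift must match them. *)
have Gall i : exists2 p, G p & tag p = i.
  apply: contrapT => nGi.
  pose Z' := Z `&` closure (D i) `&`
    \bigcup_(p : {p | G p}) closure (D (tag (sval p))).
  have cZ' : closed Z'.
    apply: closedI; first by apply: closedI => //; exact: closed_closure.
    by apply: closed_bigcup_locally_finite => // p; exact: closed_closure.
  have [||W [s [ZW st]]] := ext Z' cZ'; [by move=> z [[]] | by move=> z [] |].
  have [b0 [VU bc]] : exists b : B (V i), exists VU : V i `<=` U,
      g _ b = res C VU c.
    by exists (sval (tagged (r i))); exact: svalP (tagged (r i)).
  (* On [N] both [s] and [b0] lift [c], so their difference [d] lies in the kernel of [g]. *)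
  pose A := Opens (open_agree (g W s) c).
  pose N := opensI (opensI W (V i)) A.
  have NW : N `<=` W by move=> x [[]].
  have NV : N `<=` V i by move=> x [[]].
  pose d := res B NW s - res B NV b0.
  have gd : g N d = 0.
    apply/eqP; rewrite raddfB subr_eq0 !shfunE bc; apply/eqP.
    apply: agree_eq => x Nx; have [[Wx Vx] Ax] := Nx.
    apply: agree_trans (agree_res _ _ _) _ => //; apply: agree_trans Ax _.
    apply: agree_sym; apply: agree_trans (agree_res _ _ _) _ => //.
    exact: agree_res.
  have Z'N : Z' `<=` N.
    move=> z Z'z; have [[Zz Ciz] [p _ Cpz]] := Z'z; split; first split.
    - exact: ZW.
    - exact: Dr.
    - apply: agree_trans (agree_hom g (st _ _ Z'z (svalP p) Cpz)) _.
      by apply: agree_c; [exact: svalP | exact: Dr].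
  have [k gk kd] := softg cZ' Z'N gd.
  (* The global section [k] of the kernel has the germs of [s - b0] along [Z'], so [b1] still lifts
     [c] and has the germs of [s] there. *)
  pose b1 : B (V i) := b0 + res B (@sub_opensT _ (V i)) k.
  have gb1 : exists VU : V i `<=` U, g _ b1 = res C VU c.
    by exists VU; rewrite raddfD shfunE gk raddf0 addr0.
  have b1c p x : G p -> Z x -> closure (D (tag p)) x -> closure (D i) x ->
      agree x b1 (tagged p).
    move=> Gp Zx Cpx Cix.
    have Z'x : Z' x by split=> //; exists (exist _ p Gp).
    apply: agree_trans (st p x Z'x Gp Cpx).
    apply: (@agree_trans _ _ _ _ _ _ _ (res B NV b0 + d)).
      apply: agreeD; first exact/agree_sym/agree_res/Z'N.
      by apply: agree_trans (agree_res _ _ _) (kd _ Z'x); exact: Dr.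
    by rewrite addrC subrK; exact/agree_res/Z'N.
  pose p1 : T := existT _ i b1.
  apply: (Gmax (G `|` [set p1])).
    split; first exact: subsetUl.
    by move=> /(_ p1 (or_intror erefl)) Gp1; apply: nGi; exists p1.
  split.
  - by move=> p [/Gc //|->].
  - move=> p q [Gp|->] [Gq|->] //; first exact: Ginj.
      by move=> pi; case: nGi; exists p.
    by move=> qi; case: nGi; exists q.
  - move=> p q [Gp|->] [Gq|->] x Zx Cp Cq.
    + exact: Gcompat Cp Cq.
    + by apply: agree_sym; exact: b1c.
    + exact: b1c.
    + by apply: agree_refl; exact: Dr.
have [||W [s [ZW st]]] := ext Z cZ; first by [].
  move=> z /ZD[i _ Di]; have [p Gp pi] := Gall i.
  by exists (exist _ p Gp) => //=; rewrite pi; exact: subset_closure.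
exists W, s; split => // z Zz; have [i _ Di] := ZD z Zz.
have [p Gp pi] := Gall i.
have Cz : closure (D (tag p)) z by rewrite pi; exact: subset_closure.
apply: agree_trans (agree_hom g (st p z Zz Gp Cz)) _.
by apply: agree_c => //; exact: Dr.
Qed.

End Lift.

(** * Acyclicity of soft complexes *)

Lemma flabby_nbhd_soft (X : topologicalType) (F : sheaf X) :
  flabby F -> nbhd_soft (fun U (_ : F U) => True).
Proof.
move=> fF Z U s _ ZU _; have [t ts] := fF U s; exists t => // x Zx.
by rewrite -ts; apply/agree_sym/agree_res/ZU.
Qed.

(** The germs of [s] form a section over [Z]. Equality of stalk elements is equality of germ
    classes, so a common neighborhood is recovered from the membership of [s] in its own class. *)
Lemma soft_nbhd_soft (X : topologicalType) (F : sheaf X) :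
  soft F -> nbhd_soft (fun U (_ : F U) => True).
Proof.
move=> sF Z U s cZ ZU _.
have [x Zx|t ts] := sF Z (fun x Zx => germ (ZU x Zx) s) cZ.
  exists U, s; split; first exact: ZU.
  by move=> y Zy Uy; rewrite (Prop_irrelevance (ZU y Zy) Uy).
exists t => // x Zx; have /(congr1 sval) /= e := ts x Zx.
have : [set b | germ_eq (@LocalSect _ F x (opensT X) I t) b]
    (LocalSect (ZU x Zx) s).
  rewrite -e /=.
  exists U, (@subset_refl _ U), (@subset_refl _ U).
  by split => //; exact: (ZU x Zx).
by move=> [W [ha [hb [Wx st]]]]; exists W, ha, hb.
Qed.

(** The inclusion of the kernel of [g] in the image of [f]; for consecutive differentials of a
    complex, the reverse inclusion is [scdiffK]. *)
Definition locally_exact (X : topologicalType) (F G H : sheaf X)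
    (f : sheaf_hom F G) (g : sheaf_hom G H) : Prop :=
  forall (U : opens X) (s : G U), g U s = 0 -> forall x, oset U x ->
    exists (V : opens X) (VU : V `<=` U) (t : F V),
      oset V x /\ f V t = res G VU s.

Section Acyclic.
Variables (X : topologicalType) (N : sheaf_complex X).
Hypothesis pX : paracompact X.
Hypothesis softN : forall q, nbhd_soft (fun U (_ : N q U) => True).
Hypothesis monoN : forall U (s : N 0%N U), scdiff N 0 U s = 0 -> s = 0.
Hypothesis exactN : forall q, locally_exact (scdiff N q) (scdiff N q.+1).

Let soft_cocycles q := nbhd_soft (fun U s => scdiff N q U s = 0).

(** Softness of the cocycles in degree [q] gives a primitive near [Z], and softness of [N q] extends
    it to the whole space. *)
Lemma lift_cocycle q (Z : set X) (U : opens X) (s : N q.+1 U) :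
  soft_cocycles q -> closed Z -> Z `<=` U -> scdiff N q.+1 U s = 0 ->
  exists t : N q (opensT X), forall x, Z x -> agree x (scdiff N q _ t) s.
Proof.
move=> softq cZ ZU ds.
have [x Zx|W [b [ZW bs]]] := @lift_near _ _ _ (scdiff N q) pX softq Z U s cZ ZU.
  by apply: exactN => //; exact: ZU.
have [t _ tb] := @softN q Z W b cZ ZW I.
exists t => // x Zx; apply: agree_trans (bs x Zx).
exact/agree_hom/tb.
Qed.

(** Cocycles of degree 0 vanish. In higher degrees, the differential of a global primitive along [Z]
    is a global cocycle with the prescribed germs. *)
Lemma soft_cocyclesP q : soft_cocycles q.
Proof.
elim: q => [|q IH] Z U s cZ ZU ds.
  exists 0; first exact: raddf0.
  move=> x Zx; rewrite (monoN ds) -(raddf0 (res (N 0%N) (@sub_opensT _ U))).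
  exact/agree_sym/agree_res/ZU.
have [t ts] := lift_cocycle IH cZ ZU ds.
by exists (scdiff N q _ t) => //; exact: scdiffK.
Qed.

Lemma acyclic_soft : acyclic (sections N (opensT X)).
Proof.
case=> [|q] s ds; first by exists 0; rewrite (monoN ds).
have [t ts] := lift_cocycle (@soft_cocyclesP q) closedT
  (@subset_refl _ (opensT X)) ds.
by exists t; apply/agree_eq => x _; exact/agree_sym/ts.
Qed.

End Acyclic.

(** * Restriction of complexes to an open subspace *)

Section RestrictComplex.
Variables (X : topologicalType) (X' : opens X).

Definition restrict_hom (F G : sheaf X) (f : sheaf_hom F G) :
    sheaf_hom (sheaf_restrict X' F) (sheaf_restrict X' G) :=
  @SheafHom _ (sheaf_restrict X' F) (sheaf_restrict X' G)
    (fun U => f (opens_image U)) (fun U V h s => shfunE f _ s).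

Definition restrict_complex (N : sheaf_complex X) :
    sheaf_complex (set_type X') :=
  @SheafComplex _ (fun q => sheaf_restrict X' (N q))
    (fun q => restrict_hom (scdiff N q)) (fun q U s => scdiffK s).

Lemma restrict_exact (F G H : sheaf X) (f : sheaf_hom F G) (g : sheaf_hom G H) :
  locally_exact f g -> locally_exact (restrict_hom f) (restrict_hom g).
Proof.
move=> fg U s gs x Ux.
have [|V [VU [t [Vx ft]]]] := fg _ s gs (set_val x); first by exists x.
have oV : open (set_val @^-1` V : set (set_type X')).
  by exists V => //; exact: oopen.
have V'V : opens_image (Opens oV) `<=` V by move=> _ [y Vy <-].
have V'U : Opens oV `<=` U.
  by move=> y /= /VU[z Uz /val_inj <-].
exists (Opens oV), V'U, (res F V'V t); split=> //.
rewrite /= shfunE ft.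
exact: (@res_comp _ G _ _ _ VU V'V (image_subset set_val V'U) s).
Qed.

Lemma flabby_restrict (F : sheaf X) : flabby F -> flabby (sheaf_restrict X' F).
Proof.
move=> fF U s; have [t ts] := fF (opens_image U) s.
exists (res F (@sub_opensT _ (opens_image (opensT (set_type X')))) t).
pose h : opens_image U `<=` opens_image (opensT (set_type X')) :=
  image_subset set_val (@sub_opensT _ U).
by apply: etrans ts; exact: (res_comp (@sub_opensT _ _) h).
Qed.

(** The image of the whole subspace and [X'] are equal as sets but are different terms of [opens X];
    restrictions along the two inclusions pass between their sections. *)
Lemma acyclic_restrict (N : sheaf_complex X) :
  acyclic (sections (restrict_complex N) (opensT (set_type X'))) ->
  acyclic (sections N X').
Proof.
move=> ac.
have h1 : opens_image (opensT (set_type X')) `<=` X'.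
  by move=> _ [x _ <-]; exact: set_valP.
have h2 : X' `<=` opens_image (opensT (set_type X')).
  by move=> x X'x; exists (exist _ x (mem_set X'x)).
have uE q (u : N q X') : u = res (N q) h2 (res (N q) h1 u).
  by rewrite (res_comp h1 h2 (@subset_refl _ X')) res_id.
move=> q u du; have [|v uv] := ac q (res (N q) h1 u).
  by rewrite /= shfunE [scdiff _ _ _ _]du raddf0.
case: q u v uv {du} => [|q] u v uv.
  by exists 0; rewrite (uE _ u) uv !raddf0.
by exists (res (N q) h2 v); rewrite (uE _ u) uv /= shfunE.
Qed.

End RestrictComplex.

(** * Flabby envelopes of cokernels *)

Section DepProd.
Variables (I : Type) (M : I -> zmodType).

Definition dprod : Type := forall i, M i.
HB.instance Definition _ := gen_eqMixin dprod.
HB.instance Definition _ := gen_choiceMixin dprod.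

Definition dprod_add (f g : dprod) : dprod := fun i => f i + g i.
Definition dprod_opp (f : dprod) : dprod := fun i => - f i.
Definition dprod_zero : dprod := fun i => 0.

Fact dprod_addA : associative dprod_add.
Proof.
by move=> f g h; apply/functional_extensionality_dep => i; exact: addrA.
Qed.
Fact dprod_addC : commutative dprod_add.
Proof.
by move=> f g; apply/functional_extensionality_dep => i; exact: addrC.
Qed.
Fact dprod_add0 : left_id dprod_zero dprod_add.
Proof. by move=> f; apply/functional_extensionality_dep => i; exact: add0r. Qed.
Fact dprod_addN : left_inverse dprod_zero dprod_opp dprod_add.
Proof. by move=> f; apply/functional_extensionality_dep => i; exact: addNr. Qed.
HB.instance Definition _ :=
  GRing.isZmodule.Build dprod dprod_addA dprod_addC dprod_add0 dprod_addN.

Lemma dprodB (f g : dprod) i : (f - g) i = f i - g i.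
Proof. by []. Qed.

Lemma dprodP (f g : dprod) : (forall i, f i = g i) -> f = g.
Proof. exact: functional_extensionality_dep. Qed.

End DepProd.

Section FlabbyCokernel.
Variables (X : topologicalType) (P Q : sheaf X) (u : sheaf_hom P Q).

(* The families (s V) that are eventually a section of the image of u, for V
   shrinking to x, are divided out of the product of all Q V instead of forming
   the stalk of the cokernel of u: the quotient contains that stalk, which is
   all that is needed, and no colimit has to be built. *)
Definition families : zmodType := dprod (fun V : opens X => Q V).

Definition locally_im (x : X) : {pred families} := fun s =>
  `[< exists2 W : opens X, oset W x &
        forall V : opens X, V `<=` W -> exists p, s V = u V p >].

Fact locally_im_closed x : zmod_closed (locally_im x).
Proof.
split=> [|s t /asboolP[W Wx sW] /asboolP[W' W'x tW']]; apply/asboolP.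
  by exists (opensT X) => // V _; exists 0; rewrite raddf0.
exists (opensI W W') => // V VW.
have [p sp] := sW V (subset_trans VW (@sub_opensIl _ _ _)).
have [q tq] := tW' V (subset_trans VW (@sub_opensIr _ _ _)).
by exists (p - q); rewrite dprodB sp tq raddfB.
Qed.
HB.instance Definition _ x :=
  GRing.isZmodClosed.Build families (locally_im x) (locally_im_closed x).

Definition coker_at (x : X) : zmodType := Quotient.quot (locally_im x).

(** The value 0 on opens not contained in [U] is harmless: at a point of [U], [locally_im] only
    looks at small opens. *)
Definition restrictions (U : opens X) (s : Q U) : families := fun V =>
  match pselect (V `<=` U) with left h => res Q h s | right _ => 0 end.

Fact restrictions_additive U : zmod_morphism (@restrictions U).
Proof.
move=> s t; apply: dprodP => V; rewrite dprodB /restrictions.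
by case: pselect => h; rewrite ?raddfB ?subr0.
Qed.
HB.instance Definition _ U :=
  GRing.isZmodMorphism.Build (Q U) families (@restrictions U)
    (@restrictions_additive U).

(** Discontinuous sections, as in Godement's construction: with no continuity condition, families
    glue pointwise and extend by 0. *)
Definition fc_sect (U : opens X) : zmodType :=
  dprod (fun x : {x | oset U x} => coker_at (sval x)).

Definition fc_res_fun (U V : opens X) (h : V `<=` U) (s : fc_sect U) :
    fc_sect V :=
  fun x => s (exist _ (sval x) (h _ (svalP x))).

Fact fc_res_additive U V h : zmod_morphism (@fc_res_fun U V h).
Proof. by move=> s t; apply: dprodP. Qed.
HB.instance Definition _ U V h :=
  GRing.isZmodMorphism.Build (fc_sect U) (fc_sect V) (@fc_res_fun U V h)
    (@fc_res_additive U V h).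

Definition fc_res (U V : opens X) (h : V `<=` U) :
  {additive fc_sect U -> fc_sect V} := @fc_res_fun U V h.

Lemma fc_irrelevance (U : opens X) (s : fc_sect U) x (h h' : oset U x) :
  s (exist _ x h) = s (exist _ x h').
Proof. by rewrite (Prop_irrelevance h h'). Qed.

Fact fc_res_id (U : opens X) (h : U `<=` U) (s : fc_sect U) : fc_res h s = s.
Proof.
by apply: dprodP => -[x Ux]; rewrite /= /fc_res_fun /= (fc_irrelevance _ _ Ux).
Qed.

Fact fc_res_comp (U V W : opens X) (h : V `<=` U) (k : W `<=` V)
  (l : W `<=` U) (s : fc_sect U) : fc_res k (fc_res h s) = fc_res l s.
Proof.
by apply: dprodP => -[x Wx]; rewrite /= /fc_res_fun /=; exact: fc_irrelevance.
Qed.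

Fact fc_sep (I : Type) (U : I -> opens X) (V : opens X)
    (UV : forall i, U i `<=` V) : V `<=` \bigcup_i U i ->
  forall s t : fc_sect V, (forall i, fc_res (UV i) s = fc_res (UV i) t) ->
  s = t.
Proof.
move=> cov s t st; apply: dprodP => -[x Vx]; have [i _ Ux] := cov x Vx.
have := congr1 (fun f : fc_sect (U i) => f (exist _ x Ux)) (st i).
by rewrite /= /fc_res_fun /= !(fc_irrelevance _ _ Vx).
Qed.

Fact fc_glue (I : Type) (U : I -> opens X) (V : opens X)
    (UV : forall i, U i `<=` V) : V `<=` \bigcup_i U i ->
  forall s : forall i, fc_sect (U i),
    (forall i j, fc_res (@sub_opensIl _ (U i) (U j)) (s i)
               = fc_res (@sub_opensIr _ (U i) (U j)) (s j)) ->
    exists t : fc_sect V, forall i, fc_res (UV i) t = s i.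
Proof.
move=> cov s ss.
have covV (x : {x | oset V x}) : exists i, oset (U i) (sval x).
  by have [i _ Ux] := cov _ (svalP x); exists i.
exists (fun x => s _ (exist _ (sval x) (projT2 (cid (covV x))))) => i.
apply: dprodP => -[x Ux]; rewrite /= /fc_res_fun /=.
case: cid => j /= Ujx.
have := congr1 (fun f : fc_sect (opensI (U j) (U i)) =>
  f (exist _ x (conj Ujx Ux))) (ss j i).
by rewrite /= /fc_res_fun /= !(fc_irrelevance _ _ Ujx) !(fc_irrelevance _ _ Ux).
Qed.

Definition flabby_coker : sheaf X :=
  Sheaf fc_res_id fc_res_comp fc_sep fc_glue.

Lemma flabby_flabby_coker : flabby flabby_coker.
Proof.
move=> U s.
exists (fun x => match pselect (oset U (sval x)) return coker_at (sval x) with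
                 | left h => s (exist _ (sval x) h) | right _ => 0 end).
apply: dprodP => -[x Ux]; rewrite /= /fc_res_fun /=.
by case: pselect => // h; exact: fc_irrelevance.
Qed.

Definition to_coker_fun (U : opens X) (s : Q U) : flabby_coker U :=
  fun x => \pi_(coker_at (sval x)) (restrictions s).

Fact to_coker_additive U : zmod_morphism (@to_coker_fun U).
Proof. by move=> s t; apply: dprodP => x; rewrite /to_coker_fun !raddfB. Qed.
HB.instance Definition _ U :=
  GRing.isZmodMorphism.Build (Q U) (flabby_coker U) (@to_coker_fun U)
    (@to_coker_additive U).

Lemma pi_coker_eq0 x (s : families) :
  \pi_(coker_at x) s = 0 <-> exists2 W : opens X, oset W x &
        forall V : opens X, V `<=` W -> exists p, s V = u V p.
Proof.
have <- : \pi_(coker_at x) 0 = 0 by exact: raddf0.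
split=> [/eqP|xb]; last apply/eqP; rewrite -Quotient.idealrBE subr0.
  by move/asboolP.
exact/asboolP.
Qed.

Fact to_cokerE (U V : opens X) (h : V `<=` U) (s : Q U) :
  to_coker_fun (res Q h s) = res flabby_coker h (to_coker_fun s).
Proof.
apply: dprodP => -[x Vx]; rewrite /= /fc_res_fun /to_coker_fun /=.
apply/subr0_eq; rewrite -raddfB; apply/pi_coker_eq0; exists V => // W WV.
exists 0; rewrite raddf0 dprodB /restrictions.
case: pselect => // h1; case: pselect => [h2|[]]; last exact: subset_trans h.
by rewrite (res_comp h h1 h2) subrr.
Qed.

Definition to_coker : sheaf_hom Q flabby_coker := SheafHom to_cokerE.

Lemma to_coker_comp (U : opens X) (p : P U) : to_coker U (u U p) = 0.
Proof.
apply: dprodP => -[x Ux]; apply/pi_coker_eq0; exists U => // V VU.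
exists (res P VU p); rewrite shfunE /restrictions.
by case: pselect => // h; rewrite (Prop_irrelevance h VU).
Qed.

(** Vanishing at [x] means that all restrictions of [s] to small enough opens around [x] come from
    [u]; one of these opens suffices. *)
Lemma to_coker_exact : locally_exact u to_coker.
Proof.
move=> U s s0 x Ux.
have /pi_coker_eq0 [W Wx sW] :=
  congr1 (fun f : flabby_coker U => f (exist _ x Ux)) s0.
have [p sp] := sW (opensI U W) (@sub_opensIr _ _ _).
exists (opensI U W), (@sub_opensIl _ _ _), p; split=> //.
rewrite -sp /restrictions; case: pselect => [h|[]]; last exact: sub_opensIl.
exact: (res_eq_sub (@subset_refl _ _)).
Qed.

End FlabbyCokernel.

(** * A common flabby target for two resolutions *)

Section SheafHoms.
Variable X : topologicalType.

Section Comp.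
Variables (F G H : sheaf X) (g : sheaf_hom G H) (f : sheaf_hom F G).
Fact sh_compE (U V : opens X) (h : V `<=` U) (s : F U) :
  g V (f V (res F h s)) = res H h (g U (f U s)).
Proof. by rewrite !shfunE. Qed.
Definition sh_comp : sheaf_hom F H :=
  @SheafHom _ F H (fun U => g U \o f U) sh_compE.
End Comp.

Section Opp.
Variables (F G : sheaf X) (f : sheaf_hom F G).
Definition sh_opp_fun U (s : F U) : G U := - f U s.
Fact sh_opp_additive U : zmod_morphism (@sh_opp_fun U).
Proof. by move=> s t; rewrite /sh_opp_fun raddfB opprD. Qed.
HB.instance Definition _ U :=
  GRing.isZmodMorphism.Build (F U) (G U) (@sh_opp_fun U) (@sh_opp_additive U).
Fact sh_oppE (U V : opens X) (h : V `<=` U) (s : F U) :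
  sh_opp_fun (res F h s) = res G h (sh_opp_fun s).
Proof. by rewrite /sh_opp_fun shfunE raddfN. Qed.
Definition sh_opp : sheaf_hom F G := SheafHom sh_oppE.
End Opp.

Fact zero_sheaf_sep (I : Type) (U : I -> opens X) (V : opens X)
  (UV : forall i, U i `<=` V) : V `<=` \bigcup_i U i ->
  forall s t : zmod0, (forall i : I, idfun s = idfun t) -> s = t.
Proof. by move=> _ s t _; exact: zmod0_eq. Qed.
Fact zero_sheaf_glue (I : Type) (U : I -> opens X) (V : opens X)
    (UV : forall i, U i `<=` V) : V `<=` \bigcup_i U i ->
  forall s : I -> zmod0, (forall i j, idfun (s i) = idfun (s j)) ->
  exists t : zmod0, forall i, idfun t = s i.
Proof. by move=> _ s _; exists 0 => i; exact: zmod0_eq. Qed.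
Definition zero_sheaf : sheaf X :=
  @Sheaf X (fun _ => zmod0) (fun _ _ _ => idfun) (fun _ _ _ => erefl)
    (fun _ _ _ _ _ _ _ => erefl) zero_sheaf_sep zero_sheaf_glue.

Section Dsum.
Variables F G : sheaf X.

Definition dsum_sect (U : opens X) : zmodType := (F U * G U)%type.
Definition dsum_res_fun (U V : opens X) (h : V `<=` U) (s : dsum_sect U) :
  dsum_sect V := (res F h s.1, res G h s.2).
Fact dsum_res_additive U V h : zmod_morphism (@dsum_res_fun U V h).
Proof. by move=> s t; rewrite /dsum_res_fun !raddfB. Qed.
HB.instance Definition _ U V h :=
  GRing.isZmodMorphism.Build (dsum_sect U) (dsum_sect V) (@dsum_res_fun U V h)
    (@dsum_res_additive U V h).
Definition dsum_res U V h : {additive dsum_sect U -> dsum_sect V} :=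
  @dsum_res_fun U V h.

Fact dsum_res_id (U : opens X) (h : U `<=` U) (s : dsum_sect U) :
  dsum_res h s = s.
Proof. by case: s => s t; rewrite /= /dsum_res_fun !res_id. Qed.

Fact dsum_res_comp (U V W : opens X) (h : V `<=` U) (k : W `<=` V)
  (l : W `<=` U) (s : dsum_sect U) :
  dsum_res k (dsum_res h s) = dsum_res l s.
Proof. by rewrite /= /dsum_res_fun /= !(res_comp h k l). Qed.

Fact dsum_sep (I : Type) (U : I -> opens X) (V : opens X)
    (UV : forall i, U i `<=` V) : V `<=` \bigcup_i U i ->
  forall s t : dsum_sect V,
    (forall i, dsum_res (UV i) s = dsum_res (UV i) t) -> s = t.
Proof.
move=> cov [s s'] [t t'] st; congr pair.
  by apply: (@sheaf_sep _ F I U V UV cov) => i; exact: (congr1 fst (st i)).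
by apply: (@sheaf_sep _ G I U V UV cov) => i; exact: (congr1 snd (st i)).
Qed.

Fact dsum_glue (I : Type) (U : I -> opens X) (V : opens X)
    (UV : forall i, U i `<=` V) : V `<=` \bigcup_i U i ->
  forall s : forall i, dsum_sect (U i),
    (forall i j, dsum_res (@sub_opensIl _ (U i) (U j)) (s i)
               = dsum_res (@sub_opensIr _ (U i) (U j)) (s j)) ->
    exists t : dsum_sect V, forall i, dsum_res (UV i) t = s i.
Proof.
move=> cov s ss.
have [|t ts] := @sheaf_glue _ F I U V UV cov (fun i => (s i).1).
  by move=> i j; exact: (congr1 fst (ss i j)).
have [|t' ts'] := @sheaf_glue _ G I U V UV cov (fun i => (s i).2).
  by move=> i j; exact: (congr1 snd (ss i j)).
exists (t, t') => i; rewrite /= /dsum_res_fun /= ts ts'.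
by case: (s i).
Qed.

Definition dsum : sheaf X :=
  Sheaf dsum_res_id dsum_res_comp dsum_sep dsum_glue.

Definition sh_fst : sheaf_hom dsum F :=
  @SheafHom _ dsum F (fun U => fst) (fun U V h s => erefl).
Definition sh_snd : sheaf_hom dsum G :=
  @SheafHom _ dsum G (fun U => snd) (fun U V h s => erefl).

Section Pair.
Variables (E : sheaf X) (f : sheaf_hom E F) (g : sheaf_hom E G).
Definition sh_pair_fun U (s : E U) : dsum U := (f U s, g U s).
Fact sh_pair_additive U : zmod_morphism (@sh_pair_fun U).
Proof. by move=> s t; rewrite /sh_pair_fun !raddfB. Qed.
HB.instance Definition _ U :=
  GRing.isZmodMorphism.Build (E U) (dsum U) (@sh_pair_fun U)
    (@sh_pair_additive U).
Fact sh_pairE (U V : opens X) (h : V `<=` U) (s : E U) :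
  sh_pair_fun (res E h s) = res dsum h (sh_pair_fun s).
Proof. by rewrite /sh_pair_fun !shfunE. Qed.
Definition sh_pair : sheaf_hom E dsum := SheafHom sh_pairE.
End Pair.

Lemma nbhd_soft_dsum :
  nbhd_soft (fun U (_ : F U) => True) -> nbhd_soft (fun U (_ : G U) => True) ->
  nbhd_soft (fun U (_ : dsum U) => True).
Proof.
move=> sF sG Z U [s s'] cZ ZU _.
have [t _ ts] := sF Z U s cZ ZU I; have [t' _ ts'] := sG Z U s' cZ ZU I.
exists (t, t') => // x Zx.
have [A [h1 [h2 [Ax st]]]] := ts x Zx; have [B [k1 [k2 [Bx tr]]]] := ts' x Zx.
have hA := @sub_opensIl _ A B; have hB := @sub_opensIr _ A B.
exists (opensI A B), (subset_trans hA h1), (subset_trans hA h2).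
split=> //; congr pair; first exact: res_eq_sub st.
exact: res_eq_sub tr.
Qed.

End Dsum.

Section Zero.
Variables F G : sheaf X.
Fact sh_zeroE (U V : opens X) (h : V `<=` U) (s : F U) :
  (\0 : {additive F V -> G V}) (res F h s) =
  res G h ((\0 : {additive F U -> G U}) s).
Proof. by rewrite /= raddf0. Qed.
Definition sh_zero : sheaf_hom F G := @SheafHom _ F G (fun U => \0) sh_zeroE.
Definition sh_id : sheaf_hom F F :=
  @SheafHom _ F F (fun U => idfun) (fun U V h s => erefl).
End Zero.

Definition sh_inl (F G : sheaf X) : sheaf_hom F (dsum F G) :=
  sh_pair (sh_id F) (sh_zero F G).
Definition sh_inr (F G : sheaf X) : sheaf_hom G (dsum F G) :=
  sh_pair (sh_zero G F) (sh_id G).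

End SheafHoms.

Section Tower.
Variables (X : topologicalType) (S : sheaf X) (A : sheaf_complex X).
Variable a0 : sheaf_hom S (A 0%N).

(* With N^(-1) = S, N^n = A^n + T^(n-1) and T^n the flabby envelope of the
   cokernel of N^(n-1) -> N^n, the differential N^n -> A^(n+1) + T^n has kernel
   the image of N^(n-1).  Stage n is N^(n-1) -> N^n; its [st_part] is T^(n-1),
   which [tpart n] denotes below, so [tcomplex] starts at [tpart 1]. *)
Record stage (n : nat) := Stage {
  st_dom : sheaf X;
  st_part : sheaf X;
  st_hom : sheaf_hom st_dom (dsum (A n) st_part)
}.

Definition next_stage n (s : stage n) : stage n.+1 :=
  Stage (sh_pair (sh_comp (scdiff A n) (sh_fst (A n) (st_part s)))
                 (to_coker (st_hom s))).

Fixpoint tower n : stage n :=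
  match n with
  | 0 => Stage (sh_pair a0 (sh_zero S (zero_sheaf X)))
  | n'.+1 => next_stage (tower n')
  end.

Definition tpart n : sheaf X := st_part (tower n).

(** The [T^n] component of the differential out of [N^n]; the other component is the differential of
    [A]. *)
Definition theta n : sheaf_hom (dsum (A n) (tpart n)) (tpart n.+1) :=
  to_coker (st_hom (tower n)).

Lemma theta0 (U : opens X) (s : S U) : theta 0 U (a0 U s, 0) = 0.
Proof. exact: (to_coker_comp (st_hom (tower 0)) s). Qed.

Lemma thetaS n (U : opens X) (a : A n U) (t : tpart n U) :
  theta n.+1 U (scdiff A n U a, theta n U (a, t)) = 0.
Proof.
exact: (@to_coker_comp _ _ _ (st_hom (tower n.+1)) U (a, t)).
Qed.

Lemma theta_exact0 (U : opens X) (a : A 0%N U) (t : tpart 0 U) :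
  theta 0 U (a, t) = 0 -> forall x, oset U x ->
  exists (V : opens X) (VU : V `<=` U) (s : S V),
    oset V x /\ a0 V s = res (A 0%N) VU a.
Proof.
move=> at0 x Ux; have [V [VU [s [Vx sa]]]] := to_coker_exact at0 Ux.
by exists V, VU, s; split=> //; exact: (congr1 fst sa).
Qed.

(** The kernel of [theta] alone, with no condition on the differential of [a], is already locally
    the image of the preceding stage, because the target contains the stalks of the cokernel. *)
Lemma theta_exactS n (U : opens X) (a : A n.+1 U) (t : tpart n.+1 U) :
  theta n.+1 U (a, t) = 0 -> forall x, oset U x ->
  exists (V : opens X) (VU : V `<=` U) (b : A n V) (r : tpart n V),
    [/\ oset V x, scdiff A n V b = res (A n.+1) VU a &
        theta n V (b, r) = res (tpart n.+1) VU t].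
Proof.
move=> at0 x Ux; have [V [VU [[b r] [Vx sa]]]] := to_coker_exact at0 Ux.
exists V, VU, b, r; split=> //; first exact: (congr1 fst sa).
exact: (congr1 snd sa).
Qed.

Fact tcomplexK q (U : opens X) (t : tpart q.+1 U) :
  sh_opp (sh_comp (theta q.+2) (sh_inr (A q.+2) (tpart q.+2))) U
    (sh_opp (sh_comp (theta q.+1) (sh_inr (A q.+1) (tpart q.+1))) U t) = 0.
Proof.
rewrite /= /sh_opp_fun /= /sh_pair_fun /=.
have := @thetaS q.+1 U 0 t; rewrite raddf0 => /= t0.
transitivity (theta q.+2 U (0, theta q.+1 U (0, t))) => //.
by rewrite -raddfN; congr (theta _ _ (_, _)); rewrite /= ?oppr0 ?opprK.
Qed.

(** With this sign, the map sending [a] to [theta (a, 0)] commutes with the differentials: [thetaS]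
    gives [theta (d a, 0) = - theta (0, theta (a, 0))]. *)
Definition tcomplex : sheaf_complex X :=
  @SheafComplex _ (fun q => tpart q.+1)
    (fun q => sh_opp (sh_comp (theta q.+1) (sh_inr (A q.+1) (tpart q.+1))))
    tcomplexK.

End Tower.

(** * Exactness of the cones over the common target *)

Section Cone.
Variables (X : topologicalType) (S : sheaf X) (A : sheaf_complex X).
Variable a0 : sheaf_hom S (A 0%N).
Hypothesis a0K : forall U (s : S U), scdiff A 0 U (a0 U s) = 0.
(** [K] and [F] stand for the two summands of [A] in either order, so that one argument serves both
    resolutions. *)
Variables (K F : sheaf_complex X).
Variables (i : forall q, sheaf_hom (K q) (A q)).
Variables (j : forall q, sheaf_hom (F q) (A q)).
Variables (p : forall q, sheaf_hom (A q) (F q)).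
Hypothesis id_comm : forall q U (s : K q U),
  i q.+1 U (scdiff K q U s) = scdiff A q U (i q U s).
Hypothesis pd_comm : forall q U (s : A q U),
  p q.+1 U (scdiff A q U s) = scdiff F q U (p q U s).
Hypothesis i_inj : forall q U, injective (i q U).
Hypothesis piK : forall q U (s : K q U), p q U (i q U s) = 0.
Hypothesis p_ker : forall q U (s : A q U), p q U s = 0 -> exists k, s = i q U k.
Hypothesis jK : forall q U, cancel (j q U) (p q U).
Hypothesis resF : resolution (sh_comp (p 0%N) a0).

Local Notation T := (tpart a0).
Local Notation th := (theta a0).

Lemma thetaB q (U : opens X) (a b : A q U) (s t : T q U) :
  th q U (a - b, s - t) = th q U (a, s) - th q U (b, t).
Proof. by rewrite -raddfB. Qed.

Lemma thetaD q (U : opens X) (a b : A q U) (s t : T q U) :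
  th q U (a + b, s + t) = th q U (a, s) + th q U (b, t).
Proof. by rewrite -raddfD. Qed.

Lemma theta_res q (U V : opens X) (h : V `<=` U) (a : A q U) (t : T q U) :
  th q V (res _ h a, res _ h t) = res _ h (th q U (a, t)).
Proof. by rewrite -(shfunE (th q) h). Qed.

Fact cone_complexK q (U : opens X) (s : dsum (K q) (T q) U) :
  sh_pair (sh_comp (scdiff K q.+1) (sh_fst _ _))
    (sh_comp (th q.+1) (sh_pair (sh_comp (i q.+1) (sh_fst _ _)) (sh_snd _ _))) U
  (sh_pair (sh_comp (scdiff K q) (sh_fst _ _))
    (sh_comp (th q) (sh_pair (sh_comp (i q) (sh_fst _ _)) (sh_snd _ _))) U s)
  = 0.
Proof.
rewrite /= /sh_pair_fun /=; congr pair; first exact: scdiffK.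
transitivity (th q.+1 U (i q.+1 U (scdiff K q U s.1), th q U (i q U s.1, s.2))).
  by [].
by rewrite id_comm; exact: thetaS.
Qed.

(** The subcomplex of [N] in which the [A] component comes from [K]; up to signs, it is the cone of
    [K -> T]. *)
Definition cone_complex : sheaf_complex X :=
  @SheafComplex _ (fun q => dsum (K q) (T q)) (fun q =>
     sh_pair (sh_comp (scdiff K q) (sh_fst _ _))
       (sh_comp (th q) (sh_pair (sh_comp (i q) (sh_fst _ _)) (sh_snd _ _))))
    cone_complexK.

(** Locally [i k = a0 s]. Applying [p] kills the left side, so [s = 0] by injectivity of
    [S -> F]. *)
Lemma cone_mono (U : opens X) (s : cone_complex 0%N U) :
  scdiff cone_complex 0 U s = 0 -> s = 0.
Proof.
case: s => k t /(congr1 snd) /= th0.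
congr pair; last exact: zmod0_eq.
apply: agree_eq => x Ux.
have [V [VU [s [Vx sk]]]] := theta_exact0 th0 Ux.
have s0 : s = 0.
  case: resF => + _ _; apply.
  by rewrite [RHS]raddf0 /= sk shfunE piK raddf0.
exists V, VU, VU; split=> //; apply: (@i_inj 0%N).
by rewrite shfunE -sk s0 !raddf0.
Qed.

(* N/cone is the augmented complex S -> F, which is exact; c corrects the lift
   b found in N so that it comes from the cone of K. *)
Lemma cocycle_correction q (V : opens X) (b : A q V) x : oset V x ->
  scdiff F q V (p q V b) = 0 ->
  exists (W : opens X) (WV : W `<=` V) (c : A q W) (r : T q W),
    [/\ oset W x, scdiff A q W c = 0, th q W (c, r) = 0 &
        p q W (res _ WV b - c) = 0].
Proof.
case: resF => _ exF0 exF Vx dpb.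
case: q b dpb => [|q] b dpb.
  have [W [WV [s [Wx sb]]]] := (exF0 V _).1 dpb x Vx.
  exists W, WV, (a0 W s), 0; split=> //; first exact: theta0.
  by rewrite raddfB shfunE -sb subrr.
have [W [WV [f [Wx fb]]]] := (exF q V _).1 dpb x Vx.
exists W, WV, (scdiff A q W (j q W f)), (th q W (j q W f, 0)); split=> //.
- exact: scdiffK.
- exact: thetaS.
- by rewrite raddfB shfunE -fb pd_comm jK subrr.
Qed.

(** A local primitive [(b, r)] exists in [N]. Subtracting the cocycle [(c, r')] of
    [cocycle_correction] keeps its differential and moves the first entry into the image of [i]. *)
Lemma cone_exact q :
  locally_exact (scdiff cone_complex q) (scdiff cone_complex q.+1).
Proof.
move=> U [k t] /(congr1 snd) /= th0 x Ux.
have [V [VU [b [r [Vx db br]]]]] := theta_exactS th0 Ux.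
have dpb : scdiff F q V (p q V b) = 0.
  by rewrite -pd_comm db shfunE piK raddf0.
have [W [WV [c [r' [Wx dc cr pbc]]]]] := cocycle_correction Vx dpb.
have [k' bk] := p_ker pbc.
have WU := subset_trans WV VU.
exists W, WU, (k', res _ WV r - r'); split=> //.
congr pair.
  apply: (@i_inj q.+1); rewrite id_comm -bk raddfB dc subr0 !shfunE db.
  exact: (res_comp VU WV WU).
transitivity (th q W (i q W k', res _ WV r - r')) => //.
rewrite -bk thetaB cr subr0 theta_res br.
exact: (@res_comp X (T q.+1) U V W VU WV WU t).
Qed.

Section ConeMap.
Variable U : opens X.

Definition cone_map_fun q : {additive K q U -> T q.+1 U} :=
  sh_comp (th q) (sh_comp (sh_inl (A q) (T q)) (i q)) U.

Fact cone_mapE q (k : K q U) :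
  cone_map_fun q.+1 (scdiff K q U k) =
  scdiff (tcomplex a0) q U (cone_map_fun q k).
Proof.
rewrite /=/sh_opp_fun /= /sh_pair_fun /= id_comm.
apply/eqP; rewrite -addr_eq0; apply/eqP; rewrite -thetaD addr0 add0r.
exact: thetaS.
Qed.

Definition cone_map : nhom (sections K U) (sections (tcomplex a0) U) :=
  @NHom (sections K U) (sections (tcomplex a0) U) cone_map_fun cone_mapE.

(* The signs agree because the differential of [tcomplex] is
   - theta (0, -). *)
Lemma acyclic_cone_map :
  acyclic (sections cone_complex U) -> acyclic (cocone cone_map).
Proof.
move=> ac.
have diffS q (k : K q.+1 U) (t : T q.+1 U) :
  cocone_diff cone_map (q := q.+1) (k, t) =
  scdiff cone_complex q.+1 U (k, t) :> (K q.+2 U * T q.+2 U)%type.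
  congr pair; rewrite /= /sh_opp_fun /= /sh_pair_fun /= opprK.
  by rewrite -thetaD addr0 add0r.
have diff0 (k : K 0%N U) t :
  cocone_diff cone_map (q := 0) (k, t) =
  scdiff cone_complex 0 U (k, 0) :> (K 1 U * T 1 U)%type.
  by congr pair; rewrite /= subr0.
(* Degrees 0 and 1 involve [T^(-1)], which is [zmod0] on both sides, and need [diff0]; from degree 2
   on, only [diffS] enters. *)
case=> [|[|q]] [k t] du.
- have /(congr1 fst) /= k0 := cone_mono (etrans (esym (diff0 k t)) du).
  by exists 0; congr pair; [exact: k0 | exact: zmod0_eq].
- have [[k' t'] kt] := ac 1%N (k, t) (etrans (esym (diffS 0%N k t)) du).
  exists (k', t'); rewrite /= diff0 [LHS]kt.
  by congr (scdiff cone_complex 0 U (_, _)); exact: zmod0_eq.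
- have [[k' t'] kt] := ac q.+2 (k, t) (etrans (esym (diffS q.+1 k t)) du).
  by exists (k', t'); rewrite /= diffS.
Qed.

End ConeMap.

Variable X' : opens X.
Hypotheses (pX : paracompact X) (pX' : paracompact (set_type X')).
Hypothesis softK : forall q, nbhd_soft (fun U (_ : K q U) => True).
Hypothesis softK' : forall q,
  nbhd_soft (fun U (_ : sheaf_restrict X' (K q) U) => True).

Lemma flabby_tpart q : flabby (T q).
Proof.
case: q => [|q]; last exact: flabby_flabby_coker.
by move=> U s; exists 0; exact: zmod0_eq.
Qed.

Lemma acyclic_cone_complex : acyclic (sections cone_complex (opensT X)).
Proof.
apply: (acyclic_soft pX) => [q||]; last exact: cone_exact.
  by apply: nbhd_soft_dsum => //; exact/flabby_nbhd_soft/flabby_tpart.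
exact: cone_mono.
Qed.

Lemma acyclic_cone_complex_restrict : acyclic (sections cone_complex X').
Proof.
apply/acyclic_restrict/(acyclic_soft pX') => [q|U s|q].
- apply: (@nbhd_soft_dsum _ (sheaf_restrict X' (K q))
    (sheaf_restrict X' (T q))).
    exact: softK'.
  exact/flabby_nbhd_soft/flabby_restrict/flabby_tpart.
- exact: cone_mono.
- exact/restrict_exact/cone_exact.
Qed.

Local Notation resK := (sections_res K (@sub_opensT X X')).
Local Notation resT := (sections_res (tcomplex a0) (@sub_opensT X X')).

Fact cone_map_res q (s : K q (opensT X)) :
  cone_map X' q (resK q s) = resT q (cone_map (opensT X) q s).
Proof. exact: shfunE. Qed.

Lemma quasi_iso_cone_map :
  quasi_iso (ext_hom (@cocone_map _ _ _ _ resK resT (cone_map (opensT X))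
    (cone_map X') cone_map_res)).
Proof.
apply/acyclic_quasi_iso/acyclic_cocone_map.
  exact/acyclic_cone_map/acyclic_cone_complex.
exact/acyclic_cone_map/acyclic_cone_complex_restrict.
Qed.

End Cone.

(** * Relative sections of a flabby complex *)

Section RelativeSections.
Variables (X : topologicalType) (X' : opens X) (F : sheaf_complex X).
Local Notation resF := (sections_res F (@sub_opensT X X')).

Definition rel_incl_fun q (s : rel_sections F X' q) : cocone resF q :=
  (val s, 0).

Fact rel_incl_additive q : zmod_morphism (@rel_incl_fun q).
Proof.
by move=> s t; rewrite /rel_incl_fun raddfB; congr pair; rewrite /= subr0.
Qed.
HB.instance Definition _ q :=
  GRing.isZmodMorphism.Build (rel_sections F X' q) (cocone resF q)
    (@rel_incl_fun q) (@rel_incl_additive q).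

Fact rel_inclE q (s : rel_sections F X' q) :
  rel_incl_fun (ndiff (rel_sections F X') q s) =
  ndiff (cocone resF) q (rel_incl_fun s).
Proof. by congr pair; rewrite /= raddf0 subr0 [RHS]kernelE. Qed.

Definition rel_incl : nhom (rel_sections F X') (cocone resF) :=
  @NHom (rel_sections F X') (cocone resF) (fun q => @rel_incl_fun q) rel_inclE.

(** A cocycle amounts to [s = d t] with [t] restricting to [d t'] on [X']. Flabbiness extends [t']
    to [r] on [X], and [t - d r] is a primitive of [s] that vanishes on [X']. *)
Lemma acyclic_rel_incl : (forall q, flabby (F q)) -> acyclic (cocone rel_incl).
Proof.
move=> flF; case=> [|q] [s w] /= H.
  exists 0; congr pair; last exact: zmod0_eq.
  apply: val_inj; have := congr1 (fun z => z.2.1) H.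
  by rewrite /= subr0 => ->.
case: w H => t t' H.
have /= /eqP := congr1 (fun z => z.2.1) H; rewrite subr_eq0 => /eqP st.
have /= /eqP := congr1 (fun z => z.2.2) H.
rewrite sub0r opprB subr_eq0 => /eqP tt' {H}.
(* In the lowest case [t'] lies in [zmod0], so [t] itself vanishes on [X']. *)
case: q s t t' st tt' => [|q] s t t' st tt'.
  have xP : t \in ker_pred (res (F 0%N) (@sub_opensT _ X')).
    by rewrite inE -tt'.
  exists (Kernel xP, 0); congr (_, (_, _)).
  - exact: val_inj.
  - by rewrite /= subr0.
  - exact: zmod0_eq.
have [r rt'] := flF q X' t'.
have xP : t - scdiff F q _ r \in ker_pred (res (F q.+1) (@sub_opensT _ X')).
  by rewrite inE raddfB -shfunE rt' -tt' subrr.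
exists (Kernel xP, (- r, 0)); congr (_, (_, _)).
- by apply: val_inj; rewrite /= raddfB scdiffK subr0.
- by rewrite /= raddfN opprK subrK.
- by rewrite /= raddfN raddf0 subr0 opprK add0r rt'.
Qed.

End RelativeSections.

(** * Comparison of the two resolutions *)

Section DsumComplex.
Variables (X : topologicalType) (K F : sheaf_complex X).

Fact dsum_complexK q (U : opens X) (s : dsum (K q) (F q) U) :
  sh_pair (sh_comp (scdiff K q.+1) (sh_fst _ _))
    (sh_comp (scdiff F q.+1) (sh_snd _ _)) U
    (sh_pair (sh_comp (scdiff K q) (sh_fst _ _))
      (sh_comp (scdiff F q) (sh_snd _ _)) U s) = 0.
Proof. by congr pair; exact: scdiffK. Qed.

Definition dsum_complex : sheaf_complex X :=
  @SheafComplex _ (fun q => dsum (K q) (F q)) (fun q =>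
    sh_pair (sh_comp (scdiff K q) (sh_fst _ _))
      (sh_comp (scdiff F q) (sh_snd _ _))) dsum_complexK.

End DsumComplex.

Lemma resolution_comp0 (X : topologicalType) (S : sheaf X)
    (K : sheaf_complex X) (e : sheaf_hom S (K 0%N)) :
  resolution e -> forall U s, scdiff K 0 U (e U s) = 0.
Proof.
case=> _ ex _ U s; apply/(ex U) => x Ux.
by exists U, (@subset_refl _ U), s; split=> //; rewrite res_id.
Qed.

Theorem theorem5p16 (X : topologicalType) (X' : opens X)
    (hX : paracompact X) (hX' : paracompact (set_type X'))
    (S : sheaf X)
    (K : sheaf_complex X) (e : sheaf_hom S (K 0%N)) (hK : resolution e)
    (softK : forall q, soft (K q))
    (softK' : forall q, soft (sheaf_restrict X' (K q)))
    (F : sheaf_complex X) (e' : sheaf_hom S (F 0%N)) (hF : resolution e')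
    (flabbyF : forall q, flabby (F q)) :
  let M := cocone (sections_res K (@sub_opensT X X')) in
  derived_iso (ext M) (ext (rel_sections F X')) /\
  forall q : int,
    zmod_iso (cohomology (ext M) q) (cohomology (ext (rel_sections F X')) q).
Proof.
move=> M; pose A := dsum_complex K F.
pose a0 : sheaf_hom S (A 0%N) := sh_pair e e'.
have a0K U (s : S U) : scdiff A 0 U (a0 U s) = 0.
  transitivity (scdiff K 0 U (e U s), scdiff F 0 U (e' U s)) => //.
  by rewrite !(resolution_comp0 hK, resolution_comp0 hF).
pose N := ext (cocone (sections_res (tcomplex a0) (@sub_opensT X X'))).
have [wK qK] : exists w : bhom (ext M) N, quasi_iso w.
  eexists; apply: (@quasi_iso_cone_map X S A a0 a0K K F
    (fun q => sh_inl (K q) (F q)) (fun q => sh_inr (K q) (F q))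
    (fun q => sh_snd (K q) (F q))) => //.
  - by move=> q U s; congr pair; rewrite /= raddf0.
  - by move=> q U s t /(congr1 fst).
  - by move=> q U [s t] /= ->; exists s.
  - by move=> q; exact: soft_nbhd_soft.
  - by move=> q; exact: soft_nbhd_soft.
(* The same argument with the two summands of [A] exchanged. *)
have [wF qF] : exists w : bhom
    (ext (cocone (sections_res F (@sub_opensT X X')))) N, quasi_iso w.
  eexists; apply: (@quasi_iso_cone_map X S A a0 a0K F K
    (fun q => sh_inr (K q) (F q)) (fun q => sh_inl (K q) (F q))
    (fun q => sh_fst (K q) (F q))) => //.
  - by move=> q U s; congr pair; rewrite /= raddf0.
  - by move=> q U s t /(congr1 snd).
  - by move=> q U [s t] /= ->; exists t.
  - by move=> q; exact: flabby_nbhd_soft.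
  - by move=> q; exact/flabby_nbhd_soft/flabby_restrict.
have qR := acyclic_quasi_iso (acyclic_rel_incl (X' := X') flabbyF).
(* The zigzag runs from [M] to [N], back to the co-mapping cone of [F] along [wF], and back to the
   relative sections along [rel_incl]. *)
split.
  apply: derived_iso_trans (quasi_iso_derived qK) _.
  apply: derived_iso_trans (derived_iso_sym (quasi_iso_derived qF)) _.
  exact: derived_iso_sym (quasi_iso_derived qR).
move=> q; apply: zmod_iso_trans (quasi_iso_cohomology qK q) _.
apply: zmod_iso_trans (zmod_iso_sym (quasi_iso_cohomology qF q)) _.
exact: zmod_iso_sym (quasi_iso_cohomology qR q).
Qed.
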